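(* Let $n\ge 2$ and $K\in\mathcal{K}_o^n$. Then the $p$-affine dual curvature measures $\mathcal{I}_p(K,\cdot)$ converge weakly to the measure $n\omega_n\widetilde{C}_{n-1}^{\mathrm{a}}(K,\cdot)$ as $p\to 1^-$, where $$\widetilde{C}_{n-1}^{\mathrm{a}}(K,\eta)=\frac{n-1}{n\omega_n}\int_{\boldsymbol{\alpha}_K^*(\eta)}\rho_K(u)^{n-1}\rho_{\mathrm{I}^2K}(u)\,du\qquad\text{for Borel }\eta\subset S^{n-1}.$$
   Context: A convex body is a compact convex subset of $\mathbb{R}^n$ with nonempty interior; $\mathcal{K}_o^n$ is the set of convex bodies containing the origin in their interiors. $\omega_n$ is the volume of the unit ball of $\mathbb{R}^n$ and $V_{n-1}$ is $(n-1)$-dimensional volume. For $K\in\mathcal{K}_o^n$, the support function is $h_K(v)=\max\{x\cdot v: x\in K\}$, $v\in S^{n-1}$, and for a compact set $K$ star-shaped with respect to the origin the radial function is $\rho_K(x)=\max\{t\ge 0: tx\in K\}$, $x\in\mathbb{R}^n\setminus\{o\}$. A star body is a compact star-shaped set (with respect to the origin) whose radial function is continuous and positive on $S^{n-1}$. Spherical Lebesgue measure is denoted $du$, $dv$. Intersection body: for a star body $K$, $\mathrm{I}K$ is the star body with $\rho_{\mathrm{I}K}(u)=V_{n-1}(K\cap u^\perp)$, $u\in S^{n-1}$; and $\mathrm{I}^2K=\mathrm{I}(\mathrm{I}K)$. $L_p$ intersection body: for $p\in(-\infty,0)\cup(0,1)$ and a body $K$ (star body, in particular $K\in\mathcal{K}_o^n$),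 $\mathrm{I}_pK$ is the star body with radial function $$\rho_{\mathrm{I}_pK}(x)=\Big(\frac{1-p}{2}\int_K|x\cdot y|^{-p}\,dy\Big)^{1/p},\qquad x\in\mathbb{R}^n\setminus\{o\}.$$ $q$-cosine transform: for $q>-1$ and $f\in C(S^{n-1})$, $T_qf(u)=\int_{S^{n-1}}f(v)|u\cdot v|^q\,dv$, $u\in S^{n-1}$. Reverse radial Gauss image: for $K\in\mathcal{K}_o^n$ and $\eta\subset S^{n-1}$, $\boldsymbol{\alpha}_K^*(\eta)=\bigcup_{v\in\eta}\{u\in S^{n-1}:\rho_K(u)\,u\cdot v=h_K(v)\}$. $p$-affine dual curvature measure: for $K\in\mathcal{K}_o^n$ and Borel $\eta\subset S^{n-1}$, $$\mathcal{I}_p(K,\eta)=\frac{1-p}{2|p|}\int_{\boldsymbol{\alpha}_K^*(\eta)}\rho_K^{n-p}(v)\,T_{-p}\rho_{\mathrm{I}_pK}^{n-p}(v)\,dv .$$ *)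

(* Defs.v *)
From HB Require Import structures.
From mathcomp Require Import all_boot all_order all_algebra.
From mathcomp Require Import all_classical all_reals all_analysis measurable_realfun.
Set Implicit Arguments.
Unset Strict Implicit.
Unset Printing Implicit Defensive.
Import Order.TTheory GRing.Theory Num.Theory.
Import numFieldNormedType.Exports.
Local Open Scope classical_set_scope.
Local Open Scope ring_scope.

(* Matrices, hence vectors of R^n = 'rV[R]_n, carry their Borel sigma-algebra. *)
HB.instance Definition _ (R : realType) m n :=
  @isMeasurable.Build (sigma_display (@open 'M[R]_(m, n))) 'M[R]_(m, n)
    <<s @open 'M[R]_(m, n) >> (@sigma_algebra0 _ setT _)
    (@sigma_algebraC _ _) (@sigma_algebra_bigcup _ setT _).

Section borel_rV.
Context {R : realType}.

Lemma measurable_coord n i :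
  measurable_fun setT (fun v : 'rV[R]_n => v 0 i).
Proof.
apply: (measurability _ (RGenOpens.measurableE R)) => _ [_ [a [b ->]] <-].
rewrite setTI; apply: sub_sigma_algebra.
by move/continuousP : (@coord_continuous R 1 n 0 i); apply; exact: interval_open.
Qed.

Let box n (k : 'rV[rat]_n * nat) : set 'rV[R]_n :=
  [set v | forall i, `|ratr (k.1 0 i) - v 0 i| < k.2.+1%:R^-1].

Lemma open_bigcup_box n (U : set 'rV[R]_n) : open U ->
  U = \bigcup_(k in [set k | @box n k `<=` U]) @box n k.
Proof.
move=> oU; apply/seteqP; split=> [v Uv|v [k /= kU]]; last exact: kU.
have /nbhs_ballP [e e0 veU] : nbhs v U by exact: open_nbhs_nbhs.
have [N /= _ /(_ N (leqnn _)) Ne] :=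
  near_infty_natSinv_lt (PosNum (divr_gt0 e0 (ltr0n R 2))).
have d0 : 0 < N.+1%:R^-1 :> R by rewrite invr_gt0.
have /choice[q qv] (i : 'I_n) : exists q : rat, `|ratr q - v 0 i| < N.+1%:R^-1.
  have [|q] := @rat_in_itvoo R (v 0 i - N.+1%:R^-1) (v 0 i + N.+1%:R^-1).
    by rewrite ltrBlDr -addrA ltrDl addr_gt0.
  by rewrite in_itv/= => qv; exists q; rewrite ltr_distl.
exists (\row_i q i, N); last by move=> i /=; rewrite mxE.
move=> w /= kw; apply: veU; split => // i j; rewrite (ord1 i) /ball/=.
rewrite (splitr e) (le_lt_trans (ler_distD (ratr (q j)) _ _))// ltrD//.
  by rewrite distrC (lt_trans (qv j)).
by have := kw j; rewrite mxE => /lt_trans; apply.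
Qed.

Lemma measurable_rVP d (T : measurableType d) n (f : T -> 'rV[R]_n) :
  (forall i, measurable_fun setT (fun t => f t 0 i)) -> measurable_fun setT f.
Proof.
move=> mf; apply: (@measurability _ _ _ _ _ _ (@open 'rV[R]_n)) => // _ [U oU <-].
rewrite setTI (open_bigcup_box oU) preimage_bigcup bigcup_mkcond.
apply: countable_bigcupT_measurable => // k; case: ifPn => // _.
rewrite (_ : _ @^-1` _ = \bigcap_(i in [set: 'I_n])
    (fun t => f t 0 i) @^-1` ball (ratr (k.1 0 i) : R) k.2.+1%:R^-1); last first.
  by apply/seteqP; split=> t H i; [move=> _; exact: (H i)|exact: (H i Logic.I)].
apply: fin_bigcap_measurable => // i _; rewrite -[X in measurable X]setTI.
by apply: mf => //; apply: open_measurable; exact: ball_open.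
Qed.

Lemma sigma_additive_restr_preimage d1 d2 (T1 : measurableType d1)
    (T2 : measurableType d2) (m : {measure set T1 -> \bar R}) (D : set T1)
    (g : T1 -> T2) : measurable D -> measurable_fun setT g ->
  semi_sigma_additive (fun A => m (D `&` g @^-1` A)).
Proof.
move=> mD mg F mF tF mUF.
have mgF A : measurable A -> measurable (D `&` g @^-1` A).
  by move=> mA; apply: measurableI => //;
    rewrite -[X in measurable X]setTI; exact: mg.
rewrite preimage_bigcup setI_bigcupr; apply: measure_semi_sigma_additive.
- by move=> k; exact: mgF.
- apply/trivIsetP => /= i j _ _ ij; rewrite setIACA setIid -preimage_setI.
  by move/trivIsetP : tF => /(_ _ _ _ _ ij) ->//; rewrite preimage_set0 setI0.
- by rewrite -setI_bigcupr -preimage_bigcup; exact: mgF.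
Qed.

Lemma sigma_finite_product d1 d2 (T1 : measurableType d1)
    (T2 : measurableType d2) (m1 : {sigma_finite_measure set T1 -> \bar R})
    (m2 : {sigma_finite_measure set T2 -> \bar R}) :
  sigma_finite setT (m1 \x m2)%E.
Proof.
have /sigma_finiteP[F [TF ndF Foo]] := sigma_finiteT m1.
have /sigma_finiteP[G [TG ndG Goo]] := sigma_finiteT m2.
exists (fun k => F k `*` G k).
  rewrite -setXTT TF TG predeqE => -[x y]; split.
    move=> [/= [i _ Fix] [j _ Gjy]]; exists (maxn i j) => //; split.
    - by move: x Fix; exact/subsetPset/ndF/leq_maxl.
    - by move: y Gjy; exact/subsetPset/ndG/leq_maxr.
  by move=> [i _ []/= ? ?]; split; exists i.
move=> k; have [? ?] := Foo k; have [? ?] := Goo k.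
split; first exact: measurableX.
by rewrite product_measure1E// lte_mul_pinfty// ge0_fin_numE.
Qed.

End borel_rV.

Section lebesgue_rV.
Context {R : realType}.

Definition cons_rV n (p : measurableTypeR R * 'rV[R]_n) : 'rV[R]_n.+1 :=
  row_mx (p.1)%:M p.2.

(* n-dimensional Lebesgue measure, as the n-fold product of the one on R *)
Fixpoint lebesgue_rV n : set 'rV[R]_n -> \bar R :=
  if n is n'.+1 then
    fun A => (lebesgue_measure \x @lebesgue_rV n')%E (@cons_rV n' @^-1` A)
  else fun A => \d_(0 : 'rV[R]_0) A.

Definition split_rV n (v : 'rV[R]_n.+1) : measurableTypeR R * 'rV[R]_n :=
  (v 0 0, \row_i v 0 (lift 0 i)).

Lemma cons_rVE n p j :
  @cons_rV n p 0 j = if unlift 0 j is Some i then p.2 0 i else p.1.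
Proof.
case: unliftP => [i ->|->].
  rewrite /cons_rV /= (_ : lift 0 i = rshift 1 i :> 'I_(1 + n)).
    by rewrite (row_mxEr (p.1)%:M p.2 0 i).
  exact/val_inj.
rewrite /cons_rV /= (_ : 0 = lshift n 0 :> 'I_(1 + n)); last exact/val_inj.
by rewrite (row_mxEl (p.1)%:M p.2 0 0) mxE eqxx.
Qed.

Lemma cons_rVK n : cancel (@cons_rV n) (@split_rV n).
Proof.
move=> [t x]; rewrite /split_rV cons_rVE unlift_none; congr pair.
by apply/rowP => i; rewrite mxE cons_rVE liftK.
Qed.

Lemma measurable_cons_rV n : measurable_fun setT (@cons_rV n).
Proof.
apply: measurable_rVP => j; rewrite /=.
under eq_fun do rewrite cons_rVE.
case: (unlift 0 j) => [i|]; last exact: measurable_fst.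
exact: (measurableT_comp (measurable_coord i)).
Qed.

Lemma measurable_split_rV n : measurable_fun setT (@split_rV n).
Proof.
apply/measurable_fun_pairP; split; first exact: measurable_coord.
by apply: measurable_rVP => i /=; under eq_fun do rewrite mxE;
  exact: measurable_coord.
Qed.

Let lebesgue_rV_spec n : exists m : {sigma_finite_measure set 'rV[R]_n -> \bar R},
  @lebesgue_rV n = m.
Proof.
elim: n => [|n [m IH]].
  suff [m mE] : exists m : {sigma_finite_measure set 'rV[R]_0 -> \bar R},
    \d_(0 : 'rV[R]_0) = m by exists m; rewrite -mE.
  by exists (\d_(0 : 'rV[R]_0)).
set mu := fun A => (lebesgue_measure \x m)%E (setT `&` @cons_rV n @^-1` A).
have muE : @lebesgue_rV n.+1 = mu.
  by apply/funext => A; rewrite /mu setTI /= IH.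
have mu0 : mu set0 = 0%E by rewrite /mu preimage_set0 setI0 measure0.
have mu_ge0 A : (0 <= mu A)%E by exact: measure_ge0.
have mu_sigma : semi_sigma_additive mu.
  by apply: sigma_additive_restr_preimage => //; exact: measurable_cons_rV.
pose mu1 := isMeasure.Build _ _ _ mu mu0 mu_ge0 mu_sigma.
pose mu2 : {measure set 'rV[R]_n.+1 -> \bar R} := HB.pack mu mu1.
have mu_sf : sigma_finite setT mu2.
  have [F TF mF] := sigma_finite_product lebesgue_measure m.
  exists (fun k => @split_rV n @^-1` F k).
    by rewrite -preimage_bigcup -TF preimage_setT.
  move=> k; have [mFk Foo] := mF k; split.
    by rewrite -[X in measurable X]setTI; exact: measurable_split_rV.
  rewrite /mu2 /= /mu setTI (_ : _ @^-1` _ = F k)//.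
  by rewrite -comp_preimage; apply/seteqP; split=> p /=; rewrite cons_rVK.
pose mu3 := Measure_isSigmaFinite.Build _ _ _ mu2 mu_sf.
pose mu4 : {sigma_finite_measure set 'rV[R]_n.+1 -> \bar R} := HB.pack mu mu1 mu3.
by exists mu4; rewrite muE.
Qed.

Let lebesgue_rV0 n : @lebesgue_rV n set0 = 0%E.
Proof. by have [m ->] := lebesgue_rV_spec n. Qed.

Let lebesgue_rV_ge0 n A : (0 <= @lebesgue_rV n A)%E.
Proof. by have [m ->] := lebesgue_rV_spec n. Qed.

Let lebesgue_rV_sigma_additive n : semi_sigma_additive (@lebesgue_rV n).
Proof.
by have [m ->] := lebesgue_rV_spec n; exact: measure_semi_sigma_additive.
Qed.

HB.instance Definition _ n := isMeasure.Build _ _ _ (@lebesgue_rV n)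
  (@lebesgue_rV0 n) (@lebesgue_rV_ge0 n) (@lebesgue_rV_sigma_additive n).

Let lebesgue_rV_sigma_finite n : sigma_finite setT (@lebesgue_rV n).
Proof. by have [m ->] := lebesgue_rV_spec n; exact: sigma_finiteT. Qed.

HB.instance Definition _ n := Measure_isSigmaFinite.Build _ _ _ (@lebesgue_rV n)
  (@lebesgue_rV_sigma_finite n).

End lebesgue_rV.
Arguments lebesgue_rV {R} n.

Section euclidean.
Context {R : realType} {n : nat}.
Implicit Types (x u v : 'rV[R]_n) (A : set 'rV[R]_n).

(* The norm provided by the library on 'rV[R]_n is the maximum norm. *)
Definition dotr x v : R := \sum_i x 0 i * v 0 i.
Definition enorm x : R := Num.sqrt (dotr x x).
Definition unit_sphere : set 'rV[R]_n := [set u | enorm u = 1].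
Definition unit_ball : set 'rV[R]_n := [set x | enorm x <= 1].
Definition hyperplane u : set 'rV[R]_n := [set x | dotr x u = 0].

Definition direction x : 'rV[R]_n := (enorm x)^-1 *: x.

(* Spherical Lebesgue measure in polar coordinates, seen as a Borel measure on
   R^n carried by the unit sphere: the measure of A is n times the volume of
   the cone of all t u with 0 < t <= 1 and u a unit vector in A. *)
Definition spherical_measure A : \bar R :=
  (n%:R%:E * lebesgue_rV n
    ([set x | (0 < enorm x <= 1)%R] `&` direction @^-1` A))%E.

Lemma measurable_enorm : measurable_fun setT enorm.
Proof.
rewrite (_ : enorm = (@powR R ^~ 2^-1) \o (fun x => dotr x x)); last first.
  apply/funext => x; rewrite /= powR12_sqrt// sumr_ge0// => i _.
  by rewrite -expr2 sqr_ge0.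
apply: measurableT_comp; first exact: measurable_powR.
by apply: measurable_sum => i; apply: measurable_funM; exact: measurable_coord.
Qed.

Lemma measurable_direction : measurable_fun setT direction.
Proof.
apply: measurable_rVP => i; rewrite /direction.
rewrite (_ : (fun _ => _) = fun x => enorm x `^ (- 1) * x 0 i); last first.
  by apply/funext => x; rewrite mxE powR_inv1// sqrtr_ge0.
apply: measurable_funM; last exact: measurable_coord.
exact: (measurableT_comp (measurable_powR _) measurable_enorm).
Qed.

Let spherical_measure_spec :
  exists m : {measure set 'rV[R]_n -> \bar R}, spherical_measure = m.
Proof.
set D := [set x | 0 < enorm x <= 1].
have mD : measurable D.
  rewrite (_ : D = enorm @^-1` `]0, 1]%classic); last first.
    by apply/seteqP; split=> x /=; rewrite in_itv.
  by rewrite -[X in measurable X]setTI; exact: measurable_enorm.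
pose mu A := lebesgue_rV n (D `&` direction @^-1` A).
have mu0 : mu set0 = 0%E by rewrite /mu preimage_set0 setI0 measure0.
have mu_ge0 A : (0 <= mu A)%E by exact: measure_ge0.
have mu_sigma : semi_sigma_additive mu.
  by apply: sigma_additive_restr_preimage => //; exact: measurable_direction.
pose mu1 := isMeasure.Build _ _ _ mu mu0 mu_ge0 mu_sigma.
pose mu2 : {measure set 'rV[R]_n -> \bar R} := HB.pack mu mu1.
by exists (mscale n%:R%:nng mu2).
Qed.

Let spherical_measure0 : spherical_measure set0 = 0%E.
Proof. by have [m ->] := spherical_measure_spec. Qed.

Let spherical_measure_ge0 A : (0 <= spherical_measure A)%E.
Proof. by have [m ->] := spherical_measure_spec. Qed.

Let spherical_measure_sigma_additive : semi_sigma_additive spherical_measure.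
Proof.
by have [m ->] := spherical_measure_spec; exact: measure_semi_sigma_additive.
Qed.

HB.instance Definition _ := isMeasure.Build _ _ _ spherical_measure
  spherical_measure0 spherical_measure_ge0 spherical_measure_sigma_additive.

(* The rows form some orthonormal basis of the hyperplane orthogonal to the unit
   vector u; the volume below does not depend on which one. *)
Definition hyperplane_frame u : 'M[R]_(n.-1, n) :=
  xget 0 [set B | B *m B^T = 1%:M /\ B *m u^T = 0].

(* (n-1)-dimensional volume of a subset A of [hyperplane u], u a unit vector:
   Lebesgue measure of R^(n-1) through a linear isometry onto the hyperplane *)
Definition hyperplane_volume u A : R :=
  fine (lebesgue_rV n.-1 [set y | A (y *m hyperplane_frame u)]).

End euclidean.
Arguments unit_sphere {R} n.
Arguments unit_ball {R} n.
Arguments spherical_measure {R} n.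

Section bodies.
Context {R : realType} {n : nat}.
Implicit Types (K : set 'rV[R]_n) (u v x : 'rV[R]_n) (p q : R).

Definition convex_body_o K := [/\ compact K, convex_set K & interior K 0].

Definition support_function K v : R := sup [set dotr x v | x in K].

Definition radial_function K x : R := sup [set t | 0 <= t /\ K (t *: x)].

(* the star-shaped set whose radial function restricts to rho on the sphere *)
Definition star_set (rho : 'rV[R]_n -> R) : set 'rV[R]_n :=
  [set x | exists u t, [/\ unit_sphere n u, 0 <= t <= rho u & x = t *: u]].

Definition intersection_body K : set 'rV[R]_n :=
  star_set (fun u => hyperplane_volume u (K `&` hyperplane u)).

(* In the two integrals below the base |x.y| vanishes only on null sets, so
   that the convention 0 `^ p = 0 for p != 0 is harmless. *)
Definition Lp_intersection_body p K : set 'rV[R]_n :=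
  star_set (fun x =>
    ((1 - p) / 2 * \int[lebesgue_rV n]_(y in K) `|dotr x y| `^ (- p)) `^ p^-1).

Definition cosine_transform q (f : 'rV[R]_n -> R) u : R :=
  \int[spherical_measure n]_(v in unit_sphere n) (f v * `|dotr u v| `^ q).

(* The set eta is meant to be a subset of the sphere; its other points are
   ignored, so that the set functions below are carried by the sphere. *)
Definition reverse_radial_gauss K (eta : set 'rV[R]_n) : set 'rV[R]_n :=
  \bigcup_(v in eta `&` unit_sphere n)
    [set u | unit_sphere n u /\
             radial_function K u * dotr u v = support_function K v].

(* For Borel eta, the domain of integration below is a Borel set up to a subset
   of a Borel null set; on such a domain the library integral of a nonnegative
   Borel function (a supremum over Borel simple functions) is the integral with
   respect to the completed measure. *)
Definition p_affine_dual_curvature p K (eta : set 'rV[R]_n) : \bar R :=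
  (((1 - p) / (2 * `|p|))%R%:E *
  \int[spherical_measure n]_(v in reverse_radial_gauss K eta)
    (radial_function K v `^ (n%:R - p) *
     cosine_transform (- p)
       (fun u => radial_function (Lp_intersection_body p K) u `^ (n%:R - p))
       v)%R%:E)%E.

Definition unit_ball_volume : R := fine (lebesgue_rV n (unit_ball n)).

Definition affine_dual_curvature K (eta : set 'rV[R]_n) : \bar R :=
  ((n.-1%:R / (n%:R * unit_ball_volume))%R%:E *
  \int[spherical_measure n]_(u in reverse_radial_gauss K eta)
    (radial_function K u ^+ n.-1 *
     radial_function (intersection_body (intersection_body K)) u)%R%:E)%E.

Definition weak_cvg_sphere (mu : R -> set 'rV[R]_n -> \bar R)
    (F : set_system R) (nu : set 'rV[R]_n -> \bar R) : Prop :=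
  forall f : 'rV[R]_n -> R, {within unit_sphere n, continuous f} ->
    (\int[mu p]_(v in unit_sphere n) (f v)%:E)%E @[p --> F] -->
    (\int[nu]_(v in unit_sphere n) (f v)%:E)%E.

End bodies.
Arguments unit_ball_volume {R} n.

(* Main.v *)
(* Both measures integrate a density over the same sets alpha*_K(eta), so it is
   enough to compare the densities: if for p close to 1 they agree on the sphere up
   to factors e^(+-eps), then so do the set functions and the integrals against them
   (no regularity of alpha*_K(eta) is involved). For a body L contained in a ball
   and such that a neighbourhood of L lies in (1 + eps) L, slicing by hyperplanes
   orthogonal to v gives, uniformly in v,
     (1 - p)/2 int_L |x.v|^-p dx -> V_(n-1)(L cap v^perp)   as p -> 1-,
   since (1 - p)/2 |t|^-p dt concentrates at t = 0. With L = K this is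
   rho_(I_p K) -> rho_(I K). In polar coordinates
   T_(-p) rho_L^(n-p)(v) = (n - p) int_L |x.v|^-p dx, and the same limit with
   L = I K turns the density of I_p(K, .) into (n - 1) rho_K^(n-1) rho_(I^2 K). *)
Require Import Defs.
From mathcomp Require Import all_boot all_order all_algebra.
From mathcomp Require Import all_classical all_reals all_analysis measurable_realfun.
From mathcomp Require Import ring lra.
Set Implicit Arguments.
Unset Strict Implicit.
Unset Printing Implicit Defensive.
Import Order.TTheory GRing.Theory Num.Theory.
Import numFieldNormedType.Exports.
Local Open Scope classical_set_scope.
Local Open Scope ring_scope.

(** * Lebesgue measure under affine and orthogonal maps *)

(** T_(-p) acts on rho_(I_p K), which itself moves with p, whereas the slicing limit concerns a
    fixed body. Two-sided bounds with factors e^(+-eps) survive powers (with exponents depending on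
    p), products, and integration against |u.v|^-p, whose mass grows like 1/(1 - p); so I_p K is
    first exchanged for the fixed body I K, and only then is the limit taken. The body I K need not
    be convex when K is not symmetric, which is why slicing is carried out for a class of sets
    ([thick]) that contains convex bodies as well as star bodies with continuous positive radial
    function. The constant n - 1 is the limit of (1 - p)/(2p) times (n - p) times 2/(1 - p), that
    is, of (n - p)/p. Section volumes are read through an unspecified orthonormal frame of the
    hyperplane, so both slicing along v and comparing nearby directions rest on the orthogonal
    invariance of the product measure, which is derived here from its translation invariance. *)

Section lebesgue_affine.
Context {R : realType}.
Local Notation mu := (@lebesgue_measure R).

(** The measure [nu], c times the pushforward of [mu] under x -> c x + a, gives every half-open
    interval its length, so it is [mu] by uniqueness. *)
Lemma lebesgue_measure_affine (c a : R) (A : set (measurableTypeR R)) :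
  0 < c -> measurable A ->
  mu [set x | A (c * x + a)] = ((c^-1)%:E * mu A)%E.
Proof.
move=> c0 mA.
have mf : measurable_fun [set: measurableTypeR R]
    ((fun x => c * x + a) : measurableTypeR R -> measurableTypeR R).
  by apply: measurable_funD => //; apply: measurable_funM.
pose phi : measurableTypeR R -> measurableTypeR R := fun x => c * x + a.
pose nu : {measure set _ -> \bar R} := mscale (NngNum (ltW c0))
  (measure_function_pushforward__canonical__measure_function_Measure mu
    (mf : measurable_fun setT phi)).
have nuE B : nu B = (c%:E * mu [set z | B (c * z + a)%R])%E by [].
have -> : mu A = nu A.
  apply: (@lebesgue_measure_unique R nu _ A mA) => _ [[x y] _ <-].
  rewrite nuE.
  rewrite [X in (_ * mu X)%E](_ : _ = `](x - a) / c, (y - a) / c]%classic); last first.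
    apply/seteqP; split=> z /=; rewrite !in_itv/= ltr_pdivrMr// ler_pdivlMr//
      ltrBlDr lerBrDr (mulrC z c)//.
  rewrite !lebesgue_measure_itv/= !lte_fin ltr_pM2r ?invr_gt0// ltrD2r.
  case: ifPn => _; last by rewrite mule0.
  rewrite -EFinD -EFinM; congr EFin; rewrite -mulrBl.
  by rewrite mulrC divfK ?gt_eqF// opprD addrACA subrr addr0.
rewrite nuE muleA -EFinM mulVf ?gt_eqF// mul1e.
by [].
Qed.

Lemma ge0_integral_affine (c a : R) (f : measurableTypeR R -> \bar R) :
  0 < c -> measurable_fun setT f -> (forall x, 0 <= f x)%E ->
  (\int[mu]_x f (c * x + a)%R = (c^-1)%:E * \int[mu]_x f x)%E.
Proof.
move=> c0 mf f0.
have mphi : measurable_fun [set: measurableTypeR R]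
    ((fun x => c * x + a) : measurableTypeR R -> measurableTypeR R).
  by apply: measurable_funD => //; apply: measurable_funM.
have ic0 : 0 <= c^-1 by rewrite invr_ge0 ltW.
have := @ge0_integral_pushforward _ _ _ _ R _ mphi mu setT f measurableT mf.
rewrite preimage_setT => <- //.
rewrite -(@ge0_integral_mscale _ _ _ _ _ measurableT (NngNum ic0))//.
apply: eq_measure_integral => // A mA _.
exact: lebesgue_measure_affine.
Qed.

Lemma lebesgue_rVS n (A : set 'rV[R]_n.+1) :
  lebesgue_rV n.+1 A =
  (\int[mu]_t lebesgue_rV n [set y | A (cons_rV (t, y))])%E.
Proof.
rewrite [LHS]/=; apply: eq_integral => t _ /=; congr (lebesgue_rV n _).
by apply/seteqP; split=> y; rewrite /xsection/= ?inE.
Qed.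

Lemma measurable_scale_shift n (a : 'rV[R]_n) (c : R) :
  measurable_fun setT (fun x : 'rV[R]_n => c *: x + a).
Proof.
apply: measurable_rVP => i.
rewrite (_ : (fun _ => _) = fun t : 'rV[R]_n => c * t 0 i + a 0 i).
  by apply: measurable_funD => //; apply: measurable_funM => //;
    exact: measurable_coord.
by apply/funext => t; rewrite !mxE.
Qed.

Lemma measurable_preimage d1 d2 (T1 : measurableType d1) (T2 : measurableType d2)
  (f : T1 -> T2) A : measurable_fun setT f -> measurable A -> measurable (f @^-1` A).
Proof. by move=> mf mA; rewrite -[X in measurable X]setTI; exact: mf. Qed.

(** Induction on the dimension through the sections at fixed first coordinate: the sections scale by
    the induction hypothesis, with the tail [b] of the shift, and the first coordinate adds one
    factor 1/c. *)
Lemma lebesgue_rV_affine n (c : R) (a : 'rV[R]_n) (A : set 'rV[R]_n) :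
  0 < c -> measurable A ->
  lebesgue_rV n [set x | A (c *: x + a)] = ((c ^- n)%:E * lebesgue_rV n A)%E.
Proof.
move=> c0; elim: n a A => [|n IH] a A mA.
  rewrite expr0 invr1 mul1e; congr (lebesgue_rV 0 _).
  by apply/funext => x /=; congr A; apply/rowP => -[].
rewrite !lebesgue_rVS.
pose b := (split_rV a).2.
have E t y : c *: cons_rV (t, y) + a = cons_rV (c * t + a 0 0, c *: y + b).
  apply/rowP => j; rewrite mxE [X in X + _]mxE !cons_rVE.
  by case: unliftP => [i ->|->] //=; rewrite !mxE.
pose f t := lebesgue_rV n [set y | A (cons_rV (t, y))].
have mAc : measurable (@cons_rV R n @^-1` A).
  by apply: measurable_preimage => //; exact: measurable_cons_rV.
have mf : measurable_fun setT (f : measurableTypeR R -> \bar R).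
  have := @measurable_fun_xsection _ _ _ _ R (@lebesgue_rV R n) _ mAc.
  congr measurable_fun; apply/funext => t /=; congr (lebesgue_rV n _).
  by apply/seteqP; split=> y; rewrite /xsection/= ?inE.
transitivity (\int[mu]_t ((c ^- n)%:E * f (c * t + a 0 0)%R))%E.
  apply: eq_integral => t _; rewrite /f -(IH b).
    by congr (lebesgue_rV n _); apply/seteqP; split=> y /=; rewrite E.
  have := measurable_xsection (c * t + a 0 0) mAc.
  by congr measurable; apply/seteqP; split=> y; rewrite /xsection/= ?inE.
rewrite ge0_integralZl_EFin//; last 2 first.
- apply: measurableT_comp => //.
  by apply: measurable_funD => //; apply: measurable_funM.
- by rewrite invr_ge0 exprn_ge0// ltW.
rewrite (ge0_integral_affine (a 0 0) c0)//.
by rewrite muleA -EFinM -invfM exprSr.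
Qed.

End lebesgue_affine.

Section euclid.
Context {R : realType} {n : nat}.
Implicit Types (x y z : 'rV[R]_n) (c : R).

Lemma dotrC x y : dotr x y = dotr y x.
Proof. by apply: eq_bigr => i _; rewrite mulrC. Qed.

Lemma dotrDl x y z : dotr (x + y) z = dotr x z + dotr y z.
Proof. by rewrite /dotr -big_split; apply: eq_bigr => i _; rewrite mxE mulrDl. Qed.

Lemma dotrZl c x y : dotr (c *: x) y = c * dotr x y.
Proof. by rewrite /dotr big_distrr; apply: eq_bigr => i _; rewrite mxE /= mulrA. Qed.

Lemma dotrDr x y z : dotr x (y + z) = dotr x y + dotr x z.
Proof. by rewrite dotrC dotrDl ![dotr _ x]dotrC. Qed.

Lemma dotrZr c x y : dotr x (c *: y) = c * dotr x y.
Proof. by rewrite dotrC dotrZl dotrC. Qed.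

Lemma dotrNl x y : dotr (- x) y = - dotr x y.
Proof. by rewrite -scaleN1r dotrZl mulN1r. Qed.

Lemma dotrNr x y : dotr x (- y) = - dotr x y.
Proof. by rewrite dotrC dotrNl dotrC. Qed.

Lemma dotr_ge0 x : 0 <= dotr x x.
Proof. by apply: sumr_ge0 => i _; rewrite -expr2 sqr_ge0. Qed.

Lemma enorm_ge0 x : 0 <= enorm x. Proof. exact: sqrtr_ge0. Qed.

Lemma enorm_sqr x : enorm x ^+ 2 = dotr x x.
Proof. by rewrite sqr_sqrtr// dotr_ge0. Qed.

Lemma enormZ c x : enorm (c *: x) = `|c| * enorm x.
Proof. by rewrite /enorm dotrZl dotrZr mulrA -expr2 sqrtrM ?sqr_ge0// sqrtr_sqr. Qed.

Lemma enormN x : enorm (- x) = enorm x.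
Proof. by rewrite -scaleN1r enormZ normrN1 mul1r. Qed.

Lemma enorm0 : enorm (0 : 'rV[R]_n) = 0.
Proof. by rewrite -(scale0r 0) enormZ normr0 mul0r. Qed.

Lemma coord_le_enorm x i : `|x 0 i| <= enorm x.
Proof.
rewrite -sqrtr_sqr ler_sqrt ?dotr_ge0// /dotr (bigD1 i)//= -expr2 lerDl.
by apply: sumr_ge0 => j _; rewrite -expr2 sqr_ge0.
Qed.

Lemma enorm_eq0 x : (enorm x == 0) = (x == 0).
Proof.
apply/eqP/eqP => [x0|->]; last exact: enorm0.
apply/rowP => i; apply/eqP; rewrite mxE -normr_le0 -x0; exact: coord_le_enorm.
Qed.

Lemma enorm_gt0 x : (0 < enorm x) = (x != 0).
Proof. by rewrite lt0r enorm_eq0 enorm_ge0 andbT. Qed.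

Lemma CauchySchwarz x y : `|dotr x y| <= enorm x * enorm y.
Proof.
have [->|y0] := eqVneq y 0.
  by rewrite enorm0 mulr0 -(scale0r 0) dotrZr mul0r normr0.
have yy : 0 < dotr y y by rewrite -enorm_sqr exprn_gt0// enorm_gt0.
rewrite -ler_sqr ?nnegrE ?mulr_ge0 ?enorm_ge0// real_normK ?num_real//.
rewrite exprMn !enorm_sqr.
(* The squared norm of |y|^2 x - (x.y) y equals |y|^2 (|x|^2 |y|^2 - (x.y)^2). *)
have := dotr_ge0 (dotr y y *: x - dotr x y *: y).
rewrite !(dotrDl, dotrDr, dotrNl, dotrNr, dotrZl, dotrZr) (dotrC y x) => H.
have {H} : 0 <= dotr y y * (dotr x x * dotr y y - dotr x y ^+ 2) by nra.
by rewrite pmulr_rge0// subr_ge0.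
Qed.

Lemma ler_enormD x y : enorm (x + y) <= enorm x + enorm y.
Proof.
rewrite -ler_sqr ?nnegrE ?addr_ge0 ?enorm_ge0// sqrrD !enorm_sqr.
rewrite !(dotrDl, dotrDr) (dotrC y x).
have := le_trans (ler_norm _) (CauchySchwarz x y); lra.
Qed.

Lemma ler_enormB x y : enorm x - enorm y <= enorm (x - y).
Proof. by rewrite lerBlDr -{1}(subrK y x) ler_enormD. Qed.

Lemma enormB x y : enorm (x - y) = enorm (y - x).
Proof. by rewrite -opprB enormN. Qed.

Lemma dotrE x y : dotr x y = (x *m y^T) 0 0.
Proof. by rewrite mxE; apply: eq_bigr => i _; rewrite mxE. Qed.

Lemma measurable_dotr y : measurable_fun setT (fun x => dotr x y).
Proof.
by apply: measurable_sum => i; apply: measurable_funM => //; exact: measurable_coord.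
Qed.

End euclid.

Lemma dotr_mulmx {R : realType} m n (x : 'rV[R]_m) (y : 'rV[R]_n) (B : 'M[R]_(m, n)) :
  dotr (x *m B) y = dotr x (y *m B^T).
Proof. by rewrite !dotrE trmx_mul trmxK mulmxA. Qed.

Lemma enorm_mulmx {R : realType} m n (B : 'M[R]_(m, n)) (x : 'rV[R]_m) :
  B *m B^T = 1%:M -> enorm (x *m B) = enorm x.
Proof. by move=> BB; rewrite /enorm dotr_mulmx -mulmxA BB mulmx1. Qed.

Definition eball {R : realType} n (b : R) : set 'rV[R]_n := [set x | enorm x <= b].

Arguments eball {R} n b.

Section volume.
Context {R : realType}.

Lemma measurable_enorm_le n (b : R) : measurable (eball n b).
Proof.
rewrite (_ : eball n b = enorm @^-1` `]-oo, b]%classic); last first.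
  by apply/seteqP; split=> x /=; rewrite in_itv.
by apply: measurable_preimage => //; exact: measurable_enorm.
Qed.

Lemma measurable_cube n (c : R) :
  measurable [set x : 'rV[R]_n | forall i, `|x 0 i| <= c].
Proof.
rewrite (_ : [set _ | _] = \bigcap_(i in [set: 'I_n])
    (fun x : 'rV[R]_n => x 0 i) @^-1` `[-c, c]%classic); last first.
  apply/seteqP; split=> x /= H i; first by move=> _; rewrite /= in_itv/= -ler_norml.
  by have := H i Logic.I; rewrite /= in_itv/= -ler_norml.
apply: fin_bigcap_measurable => // i _; apply: measurable_preimage => //.
exact: measurable_coord.
Qed.

Lemma lebesgue_cube n (c : R) : 0 <= c ->
  lebesgue_rV n [set x : 'rV[R]_n | forall i, `|x 0 i| <= c] = ((2 * c) ^+ n)%:E.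
Proof.
move=> c0; elim: n => [|n IH].
  by rewrite /= expr0 diracE mem_set//= => -[].
rewrite /= (_ : _ @^-1` _ = `[-c, c]%classic `*` [set x : 'rV[R]_n | forall i, `|x 0 i| <= c]).
  rewrite product_measure1E//; last exact: measurable_cube.
  rewrite /= IH lebesgue_measure_itv/= lte_fin.
  case: ifPn => [_|]; first by rewrite -EFinD -EFinM exprS; congr EFin; ring.
  rewrite -leNgt => c0'; have -> : c = 0 by lra.
  by rewrite mul0e mulr0 expr0n.
apply/seteqP; split=> -[t x] /=.
  move=> H; split; first by have := H 0; rewrite cons_rVE unlift_none in_itv/= -ler_norml.
  by move=> i; have := H (lift 0 i); rewrite cons_rVE liftK.
rewrite in_itv/= -ler_norml => -[tc xc] i; rewrite cons_rVE.
by case: unliftP => [j _|_] //=.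
Qed.

(** Only positivity and finiteness of the volume matter, so the ball is enclosed between two cubes
    instead of being measured. *)
Lemma lebesgue_ball_bounds n (b : R) : 0 < b ->
  exists v, [/\ 0 < v & lebesgue_rV n (eball n b) = v%:E].
Proof.
move=> b0; pose c := b / n.+1%:R.
(* Points of the cube of half-side c have squared norm at most n c^2 <= b^2; the denominator n + 1
   also covers n = 0. *)
have c0 : 0 < c by rewrite divr_gt0.
have lo : (((2 * c) ^+ n)%:E <= lebesgue_rV n (eball n b))%E.
  rewrite -(lebesgue_cube n (ltW c0)).
  apply: le_measure; rewrite ?inE; [exact: measurable_cube|exact: measurable_enorm_le|].
  move=> x /= H; rewrite /eball/= -ler_sqr ?nnegrE ?enorm_ge0 ?(ltW b0)// enorm_sqr.
  apply: (@le_trans _ _ (\sum_(i < n) c ^+ 2)).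
    apply: ler_sum => i _; rewrite -expr2 -[x 0 i ^+ 2]real_normK ?num_real//.
    by rewrite ler_sqr ?nnegrE ?(ltW c0).
  rewrite sumr_const card_ord -mulr_natl /c exprMn mulrCA ger_pMr ?exprn_gt0//.
  rewrite exprVn ler_pdivrMr ?exprn_gt0// mul1r -natrX ler_nat.
  by rewrite (leq_trans (leqnSn n))// -[leqLHS]muln1 -mulnn leq_mul.
have hi : (lebesgue_rV n (eball n b) <= ((2 * b) ^+ n)%:E)%E.
  rewrite -(lebesgue_cube n (ltW b0)).
  apply: le_measure; rewrite ?inE; [exact: measurable_enorm_le|exact: measurable_cube|].
  by move=> x /= xb i; exact: le_trans (coord_le_enorm _ _) xb.
have fin : lebesgue_rV n (eball n b) \is a fin_num.
  by rewrite ge0_fin_numE ?measure_ge0// (le_lt_trans hi)// ltry.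
exists (fine (lebesgue_rV n (eball n b))).
split; last by rewrite fineK.
rewrite -lte_fin fineK//; apply: lt_le_trans lo; rewrite lte_fin exprn_gt0//.
by rewrite mulr_gt0.
Qed.

Lemma ge0_integral_rV_affine n (c : R) (a : 'rV[R]_n) (f : 'rV[R]_n -> \bar R) :
  0 < c -> measurable_fun setT f -> (forall x, 0 <= f x)%E ->
  (\int[lebesgue_rV n]_x f (c *: x + a)%R =
   (c ^- n)%:E * \int[lebesgue_rV n]_x f x)%E.
Proof.
move=> c0 mf f0.
have mphi := measurable_scale_shift a c.
have ic0 : 0 <= c ^- n by rewrite invr_ge0 exprn_ge0 ?ltW.
have := @ge0_integral_pushforward _ _ _ _ R _ mphi (lebesgue_rV n) setT f measurableT mf.
rewrite preimage_setT => <- //.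
rewrite -(@ge0_integral_mscale _ _ _ _ _ measurableT (NngNum ic0))//.
apply: eq_measure_integral => // A mA _.
exact: lebesgue_rV_affine.
Qed.

Lemma measurable_mulmx m n (B : 'M[R]_(m, n)) :
  measurable_fun setT (fun x : 'rV[R]_m => x *m B).
Proof.
apply: measurable_rVP => i.
rewrite (_ : (fun _ => _) = fun t : 'rV[R]_m => \sum_j t 0 j * B j i).
  by apply: measurable_sum => j; apply: measurable_funM => //; exact: measurable_coord.
by apply/funext => t; rewrite mxE.
Qed.

End volume.

Section orthogonal.
Context {R : realType}.

Lemma measurable_fun_EFin_indic d (T : measurableType d) (A : set T) :
  measurable A -> measurable_fun setT (fun x => (\1_A x : R)%:E).
Proof. by move=> mA; apply/measurable_EFinP; exact: measurable_indic. Qed.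

Lemma integral_indic_set d (T : measurableType d) (mu : {measure set T -> \bar R})
  (A : set T) : measurable A -> (\int[mu]_x (\1_A x)%:E = mu A)%E.
Proof. by move=> mA; rewrite integral_indic// setIT. Qed.

Lemma EFin_indic_ge0 T (A : set T) x : (0 <= (\1_A x : R)%:E)%E.
Proof. by rewrite lee_fin. Qed.

Lemma ge0_integralTZl d (T : measurableType d) (mu : {measure set T -> \bar R})
    (k : \bar R) (f : T -> \bar R) :
  (0 <= k)%E -> (forall x, 0 <= f x)%E -> measurable_fun setT f ->
  (\int[mu]_x (k * f x) = k * \int[mu]_x f x)%E.
Proof. by move=> k0 f0 mf; apply: ge0_integralZl. Qed.

(* With E the unit ball and mu(B) = lam {x | x Q in B}, the double integral of
   (x, y) |-> 1_E(x Q) 1_B(y + x Q) is lam(B) lam(E) by translation invariance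
   in y, and lam(E) mu(B) by translation invariance in x. *)
Lemma translation_invariant_orth n
    (lam : {sigma_finite_measure set 'rV[R]_n -> \bar R}) (v : R)
    (Q : 'M[R]_n) (B : set 'rV[R]_n) :
  (forall a (f : 'rV[R]_n -> \bar R), measurable_fun setT f -> (forall x, 0 <= f x)%E ->
     \int[lam]_x f (x + a)%R = \int[lam]_x f x)%E ->
  0 < v -> lam (eball n 1) = v%:E ->
  Q *m Q^T = 1%:M -> measurable B -> lam [set x | B (x *m Q)] = lam B.
Proof.
move=> lamD v0 vE QQ mB; have QQ' := mulmx1C QQ.
pose E := eball n (1 : R); have mE : measurable E by exact: measurable_enorm_le.
have mBQ : measurable [set x | B (x *m Q)].
  exact: (measurable_preimage (measurable_mulmx Q)).
have m1 : measurable_fun setT (fun z : 'rV[R]_n * 'rV[R]_n => z.1 *m Q).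
  exact: (measurableT_comp (measurable_mulmx Q)).
have mcoord1 i : measurable_fun setT (fun z : 'rV[R]_n * 'rV[R]_n => (z.1 *m Q) 0 i).
  exact: (measurableT_comp (measurable_coord i)).
have mcoord2 i : measurable_fun setT (fun z : 'rV[R]_n * 'rV[R]_n => z.2 0 i).
  exact: (measurableT_comp (measurable_coord i)).
have mD : measurable_fun setT (fun z : 'rV[R]_n * 'rV[R]_n => z.2 + z.1 *m Q).
  apply: measurable_rVP => i; rewrite (_ : (fun _ => _) = fun z : 'rV[R]_n * 'rV[R]_n =>
    z.2 0 i + (z.1 *m Q) 0 i); first exact: measurable_funD.
  by apply/funext => z; rewrite !mxE.
have mS : measurable_fun setT (fun z : 'rV[R]_n * 'rV[R]_n => z.1 *m Q - z.2).
  apply: measurable_rVP => i; rewrite (_ : (fun _ => _) = fun z : 'rV[R]_n * 'rV[R]_n =>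
    (z.1 *m Q) 0 i - z.2 0 i); first exact: measurable_funB.
  by apply/funext => z; rewrite !mxE.
pose f (z : 'rV[R]_n * 'rV[R]_n) : \bar R :=
  (\1_E (z.1 *m Q) * \1_B (z.2 + z.1 *m Q))%:E.
pose g (z : 'rV[R]_n * 'rV[R]_n) : \bar R :=
  (\1_E (z.1 *m Q - z.2) * \1_B (z.1 *m Q))%:E.
have mf : measurable_fun setT f.
  apply/measurable_EFinP; apply: measurable_funM.
    by apply: (measurableT_comp _ m1); exact: measurable_indic.
  by apply: (measurableT_comp _ mD); exact: measurable_indic.
have mg : measurable_fun setT g.
  apply/measurable_EFinP; apply: measurable_funM.
    by apply: (measurableT_comp _ mS); exact: measurable_indic.
  by apply: (measurableT_comp _ m1); exact: measurable_indic.
have f0 z : (0 <= f z)%E by rewrite lee_fin mulr_ge0.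
have g0 z : (0 <= g z)%E by rewrite lee_fin mulr_ge0.
have L : (\int[lam]_x \int[lam]_y f (x, y) =
    lam B * v%:E)%E.
  transitivity (\int[lam]_x
      (lam B * (\1_[set x | E (x *m Q)] x)%:E))%E.
    apply: eq_integral => x _; rewrite /f/=.
    under eq_integral do rewrite EFinM.
    have mBx : measurable_fun setT (fun y : 'rV[R]_n => (\1_B (y + x *m Q))%:E : \bar R).
      apply/measurable_EFinP; apply: (measurableT_comp (measurable_indic mB)).
      by have := measurable_scale_shift (x *m Q) 1; congr measurable_fun; apply/funext => y;
        rewrite scale1r.
    rewrite (ge0_integralTZl lam (EFin_indic_ge0 _ _) (fun y => EFin_indic_ge0 _ _) mBx).
    rewrite muleC; congr (_ * _)%E; rewrite -[RHS](integral_indic_set _ mB).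
    by rewrite -(lamD (x *m Q) (fun y => (\1_B y)%:E) (measurable_fun_EFin_indic mB)
      (EFin_indic_ge0 B)).
  have mEQ : measurable [set x | E (x *m Q)].
    exact: (measurable_preimage (measurable_mulmx Q)).
  rewrite (ge0_integralTZl lam (measure_ge0 lam B) (EFin_indic_ge0 _)
    (measurable_fun_EFin_indic mEQ)).
  rewrite (integral_indic_set _ mEQ); congr (_ * _)%E; rewrite -vE; congr (lam _).
  by apply/seteqP; split=> x; rewrite /E/eball/= enorm_mulmx.
have S : (\int[lam]_x \int[lam]_y f (x, y) =
    \int[lam]_x \int[lam]_y g (x, y))%E.
  rewrite (fubini_tonelli f mf f0) [RHS](fubini_tonelli g mg g0).
  apply: eq_integral => y _.
  have mfy : measurable_fun setT (fun x => f (x, y)).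
    by apply: (measurableT_comp mf); exact: measurable_pair2.
  (* For fixed y, replacing x by x - y Q^T turns x Q into x Q - y, hence [f] into [g]. *)
  rewrite -(lamD (- (y *m Q^T)) (fun x => f (x, y)) mfy (fun x => f0 (x, y))).
  apply: eq_integral => x _.
  rewrite /f/g/= mulmxBl -mulmxA QQ' mulmx1.
  by congr (_ * \1_B _)%:E; rewrite addrC subrK.
have Rr : (\int[lam]_x \int[lam]_y g (x, y) =
    lam [set x | B (x *m Q)] * v%:E)%E.
  transitivity (\int[lam]_x
      (v%:E * (\1_[set x | B (x *m Q)] x)%:E))%E.
    apply: eq_integral => x _; rewrite /g/=.
    under eq_integral do rewrite mulrC EFinM.
    have mEx : measurable_fun setT (fun y : 'rV[R]_n => (\1_E (x *m Q - y))%:E : \bar R).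
      apply/measurable_EFinP; apply: (measurableT_comp (measurable_indic mE)).
      by have := measurable_scale_shift (x *m Q) (-1); congr measurable_fun;
        apply/funext => y; rewrite scaleN1r addrC.
    rewrite (ge0_integralTZl lam (EFin_indic_ge0 _ _) (fun y => EFin_indic_ge0 _ _) mEx).
    rewrite muleC; congr (_ * _)%E; rewrite -vE -[RHS](integral_indic_set _ mE).
    rewrite -(lamD (- (x *m Q)) (fun y => (\1_E y)%:E) (measurable_fun_EFin_indic mE)
      (EFin_indic_ge0 E)).
    apply: eq_integral => y _; rewrite !indicE.
    by congr (_ %:R)%:E; congr nat_of_bool; apply/idP/idP; rewrite !inE /E/eball/= enormB.
  rewrite (ge0_integralTZl lam _ (EFin_indic_ge0 _) (measurable_fun_EFin_indic mBQ)).
    by rewrite (integral_indic_set _ mBQ) muleC.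
  by rewrite lee_fin ltW.
move: S; rewrite L Rr => /(congr1 (fun z => z * (v^-1)%:E)%E).
by rewrite -!muleA -EFinM mulfV ?gt_eqF// !mule1.
Qed.

Lemma lebesgue_rV_orth n (Q : 'M[R]_n) (B : set 'rV[R]_n) :
  Q *m Q^T = 1%:M -> measurable B ->
  lebesgue_rV n [set x | B (x *m Q)] = lebesgue_rV n B.
Proof.
have [v [v0 vE]] := @lebesgue_ball_bounds R n 1 ltr01.
apply: (@translation_invariant_orth n (lebesgue_rV n) v) => // a f mf f0.
have := ge0_integral_rV_affine a ltr01 mf f0.
by rewrite expr1n invr1 mul1e => <-; apply: eq_integral => x _; rewrite scale1r.
Qed.

End orthogonal.

(** * Reflections and orthonormal frames of hyperplanes *)

Section reflection.
Context {R : realType} {n : nat}.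
Implicit Types (d x : 'rV[R]_n).

(* For d = 0 the division gives 0, so that reflection 0 is the identity. *)
Definition reflection d : 'M[R]_n := 1%:M - (2 / dotr d d) *: (d^T *m d).

Lemma tr_reflection d : (reflection d)^T = reflection d.
Proof. by rewrite /reflection linearB/= linearZ/= trmx1 trmx_mul trmxK. Qed.

Lemma mulmx_reflection x d :
  x *m reflection d = x - (2 * dotr x d / dotr d d) *: d.
Proof.
rewrite /reflection mulmxBr mulmx1 -scalemxAr mulmxA.
rewrite (mx11_scalar (x *m d^T)) mul_scalar_mx -dotrE scalerA.
by congr (_ - _ *: _); rewrite mulrAC.
Qed.

Lemma reflection_orth d : reflection d *m (reflection d)^T = 1%:M.
Proof.
rewrite tr_reflection; apply/row_matrixP => i; rewrite row_mul.
set x := row i _; rewrite mulmx_reflection.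
have -> : x = row i 1%:M *m reflection d by rewrite -row_mul mul1mx.
set e := row i 1%:M; rewrite mulmx_reflection.
have [->|d0] := eqVneq d 0; first by rewrite !scaler0 !subr0.
have dd : dotr d d != 0 by rewrite -enorm_sqr expf_eq0/= enorm_eq0.
rewrite dotrDl dotrNl dotrZl -addrA -opprD -scalerDl.
have -> : 2 * dotr e d / dotr d d +
    2 * (dotr e d - 2 * dotr e d / dotr d d * dotr d d) / dotr d d = 0.
  by field; exact: dd.
by rewrite scale0r subr0.
Qed.

End reflection.

Section frames.
Context {R : realType} {m : nat}.
Implicit Types (u v w : 'rV[R]_m.+1) (B : 'M[R]_(m, m.+1)).

Definition is_frame u B := B *m B^T = 1%:M /\ B *m u^T = 0.

Lemma unit_sphere_dotr u : unit_sphere m.+1 u -> dotr u u = 1.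
Proof. by move=> uu; rewrite -enorm_sqr uu expr1n. Qed.

(** The reflection in the hyperplane orthogonal to e - u sends the first basis vector e to u. Its
    matrix is orthogonal with first row u, so the other rows form a frame. *)
Lemma exists_frame u : unit_sphere m.+1 u -> exists B, is_frame u B.
Proof.
move=> uS; pose e : 'rV[R]_m.+1 := delta_mx 0 0.
have ee : dotr e e = 1 by rewrite dotrE trmx_delta mul_delta_mx mxE.
pose H := reflection (e - u).
have eH : row 0 H = u.
  rewrite -[H]mul1mx row_mul row1 mulmx_reflection -/e.
  (* For e = u the reflection is the identity; otherwise the claim amounts to 2 e.(e - u) = |e -
     u|^2, valid for unit vectors. *)
  have [->|eu] := eqVneq e u; first by rewrite subrr scaler0 subr0.
  have dd : dotr (e - u) (e - u) != 0 by rewrite -enorm_sqr expf_eq0/= enorm_eq0 subr_eq0.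
  rewrite (_ : 2 * _ = dotr (e - u) (e - u)) ?divff// ?scale1r ?subKr//.
  rewrite !(dotrDl, dotrDr, dotrNl, dotrNr) ee (unit_sphere_dotr uS) (dotrC u e).
  by ring.
have HH i j : dotr (row i H) (row j H) = (i == j)%:R.
  have <- : (H *m H^T) i j = (i == j)%:R by rewrite reflection_orth mxE.
  by rewrite mxE; apply: eq_bigr => k _; congr (_ * _); rewrite [LHS]mxE// [RHS]mxE.
pose B : 'M[R]_(m, m.+1) := \matrix_i row (lift 0 i) H.
have BE i : row i B = row (lift 0 i) H by rewrite rowK.
exists B; split.
  apply/matrixP => i j; have := HH (lift 0 i) (lift 0 j).
  rewrite (inj_eq lift_inj) -!BE => BB; rewrite [RHS]mxE -BB [LHS]mxE.
  by apply: eq_bigr => k _; rewrite [row i B _ _]mxE [row j B _ _]mxE [B^T _ _]mxE.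
apply/row_matrixP => i; rewrite row_mul BE -[u]eH row0.
by apply/rowP => j; rewrite (ord1 j) -dotrE HH mxE.
Qed.

Lemma hyperplane_frameP u : unit_sphere m.+1 u -> is_frame u (hyperplane_frame u).
Proof. by move=> /exists_frame uB; exact: (@xgetPex _ 0
  [set B : 'M[R]_(m.+1.-1, m.+1) | B *m B^T = 1%:M /\ B *m u^T = 0] uB). Qed.

Lemma frame_orth u B : unit_sphere m.+1 u -> is_frame u B ->
  (col_mx u B : 'M[R]_(1 + m)) *m (col_mx u B)^T = 1%:M.
Proof.
move=> uS [BB Bu].
rewrite tr_col_mx mul_col_row BB Bu.
have -> : u *m u^T = 1%:M.
  by rewrite [LHS]mx11_scalar -dotrE unit_sphere_dotr.
have -> : u *m B^T = 0 by rewrite -[LHS]trmxK trmx_mul trmxK Bu trmx0.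
by rewrite -scalar_mx_block.
Qed.

Lemma frame_decomp u B : unit_sphere m.+1 u -> is_frame u B ->
  u^T *m u + B^T *m B = 1%:M.
Proof.
move=> uS uB; have := mulmx1C (frame_orth uS uB).
by rewrite tr_col_mx mul_row_col.
Qed.

Lemma frame_dotr u B (y : 'rV[R]_m) : is_frame u B -> dotr (y *m B) u = 0.
Proof. by case=> _ Bu; rewrite dotrE -mulmxA Bu mulmx0 mxE. Qed.

(** Two frames of u^perp differ by the orthogonal matrix B B'^T of R^m; hence the choice made by
    [xget] in [hyperplane_frame] does not affect volumes. *)
Lemma frame_volume u B B' (A : set 'rV[R]_m.+1) :
  unit_sphere m.+1 u -> is_frame u B -> is_frame u B' -> measurable A ->
  lebesgue_rV m [set y | A (y *m B)] = lebesgue_rV m [set y | A (y *m B')].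
Proof.
move=> uS uB uB' mA; have [BB Bu] := uB; have [BB' Bu'] := uB'.
have BE : B = B *m B'^T *m B'.
  by rewrite -mulmxA -[LHS]mulmx1 -(frame_decomp uS uB') mulmxDr mulmxA Bu mul0mx add0r.
pose C := B *m B'^T.
have CC : C *m C^T = 1%:M.
  by rewrite /C trmx_mul trmxK mulmxA -BE.
have mB' : measurable [set y | A (y *m B')].
  exact: (measurable_preimage (measurable_mulmx B')).
rewrite -(lebesgue_rV_orth CC mB').
congr (lebesgue_rV m _); apply/seteqP; split=> y /=; rewrite -mulmxA -BE//.
Qed.

(** The reflection along u + w sends w to -u. The one along u - w would also exchange the two
    hyperplanes, but it moves x in u^perp by 2 |x.(u - w)| / |u - w|, which does not become small as
    w tends to u. *)
Lemma reflection_frame u w B : unit_sphere m.+1 u -> unit_sphere m.+1 w ->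
  u + w != 0 -> is_frame u B -> is_frame w (B *m reflection (u + w)).
Proof.
move=> uS wS uw0 [BB Bu]; split.
  by rewrite trmx_mul mulmxA -(mulmxA B) reflection_orth mulmx1.
have dd : dotr (u + w) (u + w) != 0 by rewrite -enorm_sqr expf_eq0/= enorm_eq0.
have wE : w *m reflection (u + w) = - u.
  rewrite mulmx_reflection (_ : 2 * _ = dotr (u + w) (u + w)).
    by rewrite divff// scale1r opprD addrCA subrr addr0.
  by rewrite !(dotrDl, dotrDr) !unit_sphere_dotr// (dotrC w u); ring.
rewrite -mulmxA -[reflection _ *m _]trmxK trmx_mul trmxK tr_reflection wE.
by rewrite linearN/= mulmxN Bu oppr0.
Qed.

Lemma ge0_integral_cons (F : 'rV[R]_m.+1 -> \bar R) :
  measurable_fun setT F -> (forall x, 0 <= F x)%E ->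
  (\int[lebesgue_rV m.+1]_x F x =
   \int[lebesgue_measure]_t \int[lebesgue_rV m]_y F (cons_rV (t, y)))%E.
Proof.
move=> mF F0.
have mcF : measurable_fun setT (F \o @cons_rV R m).
  exact: (measurableT_comp mF (@measurable_cons_rV R m)).
rewrite -(@fubini_tonelli1 _ _ _ _ _ lebesgue_measure (lebesgue_rV m) _ mcF (fun x => F0 _)).
have := @ge0_integral_pushforward _ _ _ _ R _ (@measurable_cons_rV R m)
  (lebesgue_measure \x lebesgue_rV m)%E setT F measurableT mF (fun x _ => F0 x).
rewrite preimage_setT => <-.
apply: eq_measure_integral => [|? A mA _]; first exact: measurable_cons_rV.
by [].
Qed.

Lemma ge0_integral_rV_orth n (Q : 'M[R]_n) (F : 'rV[R]_n -> \bar R) :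
  Q *m Q^T = 1%:M -> measurable_fun setT F -> (forall x, 0 <= F x)%E ->
  (\int[lebesgue_rV n]_x F (x *m Q)%R = \int[lebesgue_rV n]_x F x)%E.
Proof.
move=> QQ mF F0.
have := @ge0_integral_pushforward _ _ _ _ R _ (measurable_mulmx Q)
  (lebesgue_rV n) setT F measurableT mF (fun x _ => F0 x).
rewrite preimage_setT => <-.
apply: eq_measure_integral => [|? A mA _]; first exact: measurable_mulmx.
exact: lebesgue_rV_orth QQ mA.
Qed.

(** The matrix with rows u and B is orthogonal, so rotating by it reduces the claim to Tonelli in
    the first coordinate. *)
Lemma ge0_integral_slices u B (F : 'rV[R]_m.+1 -> \bar R) :
  unit_sphere m.+1 u -> is_frame u B ->
  measurable_fun setT F -> (forall x, 0 <= F x)%E ->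
  (\int[lebesgue_rV m.+1]_x F x =
   \int[lebesgue_measure]_t \int[lebesgue_rV m]_y F (t *: u + y *m B)%R)%E.
Proof.
move=> uS uB mF F0.
rewrite -(ge0_integral_rV_orth (frame_orth uS uB) mF F0).
have mFQ : measurable_fun setT (fun x : 'rV[R]_m.+1 => F (x *m (col_mx u B : 'M[R]_(1 + m)))).
  exact: (measurableT_comp mF (measurable_mulmx _)).
rewrite (ge0_integral_cons mFQ (fun x => F0 _)).
apply: eq_integral => t _; apply: eq_integral => y _; congr F.
by have := mul_row_col (t%:M : 'M[R]_1) y u B; rewrite mul_scalar_mx.
Qed.

End frames.

(** * Polar coordinates *)

Section power_integrals.
Context {R : realType}.
Local Notation mu := (@lebesgue_measure R).
Implicit Types (a b k : R).

Lemma derivable_powR_div k a x : 0 < x -> derivable (fun s : R => s `^ a / k) x 1.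
Proof.
move=> x0; apply: derivableM; last exact: derivable_cst.
by apply: derivable_powR; rewrite in_itv/= x0.
Qed.

Lemma derive1_powR_div k x : k != 0 -> 0 < x ->
  (fun s : R => s `^ k / k)^`()%classic x = x `^ (k - 1).
Proof.
move=> k0 x0; rewrite derive1E deriveM//; last first.
  by apply: derivable_powR; rewrite in_itv/= x0.
rewrite derive_cst scaler0 add0r -derive1E powR_derive1 ?in_itv/= ?x0//.
by rewrite /GRing.scale/= mulrA mulVf// mul1r.
Qed.

Lemma powR_continuous_at a x : 0 < x -> {for x, continuous (fun s : R => s `^ a)}.
Proof.
move=> x0; apply/differentiable_continuous; rewrite -derivable1_diffP.
by apply: derivable_powR; rewrite in_itv/= x0.
Qed.

Lemma integral_powR_itv k a b : k != 0 -> 0 < a < b ->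
  (\int[mu]_(s in `[a, b]) (s `^ (k - 1))%:E = (b `^ k / k - a `^ k / k)%:E)%E.
Proof.
move=> k0 /andP[a0 ab].
rewrite (@continuous_FTC2 _ _ (fun s : R => s `^ k / k))//.
- apply: derivable_within_continuous => x; rewrite in_itv/= => /andP[ax _].
  by apply: derivable_powR; rewrite in_itv/= (lt_le_trans a0).
- split.
  + by move=> x; rewrite in_itv/= => /andP[ax _]; apply: derivable_powR_div; exact: lt_trans ax.
  + apply: cvg_at_right_filter; apply: cvgMl; exact: powR_continuous_at.
  + apply: cvg_at_left_filter; apply: cvgMl; apply: powR_continuous_at.
    exact: lt_trans ab.
- by move=> x; rewrite in_itv/= => /andP[ax _]; apply: derive1_powR_div => //; exact: lt_trans ax.
Qed.

Lemma integral_powR_ay k a : 0 < k -> 0 < a ->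
  (\int[mu]_(s in `[a, +oo[) (s `^ (- k - 1))%:E = (a `^ (- k) / k)%:E)%E.
Proof.
move=> k0 a0.
have k0' : - k != 0 by rewrite oppr_eq0 gt_eqF.
rewrite (@ge0_continuous_FTC2y _ _ (fun s : R => s `^ (- k) / (- k)) a 0).
- by rewrite -EFinD sub0r invrN mulrN opprK.
- by move=> x _; exact: powR_ge0.
- apply: derivable_within_continuous => x; rewrite in_itv/= andbT => ax.
  by apply: derivable_powR; rewrite in_itv/= (lt_le_trans a0).
- rewrite -[0 in X in _ --> X](mul0r (- k)^-1); apply: cvgMl.
  rewrite (_ : (fun _ => _) = unstable.inv_fun (fun s : R => s `^ k)); last first.
    by apply/funext => s /=; rewrite powRN.
  apply/gtr0_cvgV0.
    by near=> s; apply: powR_gt0; near: s; exact: nbhs_pinfty_gt.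
  apply/cvgryPge => A; near=> s.
  have s1 : 1 <= s by near: s; apply: nbhs_pinfty_ge.
  have : (Num.max A 1) `^ k^-1 <= s by near: s; apply: nbhs_pinfty_ge; rewrite num_real.
  move=> /(@ge0_ler_powR _ k (ltW k0)) H.
  apply: (@le_trans _ _ (Num.max A 1)); first by rewrite le_max lexx.
  have := H (powR_ge0 _ _) (le_trans ler01 s1).
  by rewrite -powRrM mulVf ?gt_eqF// powRr1// le_max ler01 orbT.
- by move=> x ax; apply: derivable_powR_div; exact: lt_trans ax.
- apply: cvg_at_right_filter; apply: cvgMl; exact: powR_continuous_at.
- move=> x; rewrite in_itv/= andbT => ax; apply: derive1_powR_div => //; exact: lt_trans ax.
Unshelve. all: by end_near. Qed.

Lemma integral_powR_0b k b : 0 < k -> 0 < b ->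
  (\int[mu]_(s in `]0%R, b]) (s `^ (k - 1))%:E = (b `^ k / k)%:E)%E.
Proof.
move=> k0 b0.
(* The integrand may be singular at 0, so the interval is exhausted from the right; i + 2 keeps the
   left end strictly below b. *)
pose F (i : nat) := `[b / i.+2%:R, b]%classic : set R.
have Fpos i : 0 < b / i.+2%:R < b.
  by rewrite divr_gt0//= ltr_pdivrMr// ltr_pMr// ltr1n.
have FU : \bigcup_i F i = `]0, b]%classic.
  apply/seteqP; split=> [x [i _]|x]; rewrite /F /= !in_itv/= => /andP[h xb].
    by rewrite xb andbT; apply: lt_le_trans h; case/andP: (Fpos i).
  have [N /= _ NH] := near_infty_natSinv_lt (PosNum (divr_gt0 h b0)).
  exists N => //=; rewrite in_itv/= xb andbT ler_pdivrMr//.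
  have := NH N (leqnn _); rewrite /= ltr_pdivlMr// ltr_pdivrMl// => /ltW/le_trans; apply.
  by rewrite mulrC ler_pM2l// ler_nat.
have mF i : measurable (F i) by exact: measurable_itv.
have mf : measurable_fun setT (fun s : R => (s `^ (k - 1))%:E : \bar R).
  by apply/measurable_EFinP; exact: measurable_powR.
have := @ge0_nondecreasing_set_cvg_integral _ (measurableTypeR R) R F
  (fun s : R => (s `^ (k - 1))%:E) (@lebesgue_measure R).
rewrite FU => H.
have {}H : (\int[mu]_(x in F i) (x `^ (k - 1))%:E @[i --> \oo] -->
    \int[mu]_(x in `]0%R, b]) (x `^ (k - 1))%:E)%E.
  apply: H => //.
  - move=> i j ij; apply/subsetPset => x; rewrite /F /= !in_itv/= => /andP[h ->].
    rewrite andbT (le_trans _ h)// ler_pM2l// lef_pV2 ?posrE// ler_nat.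
    by rewrite !ltnS.
  - by move=> i; exact: measurable_funTS.
  - by move=> i x _; rewrite lee_fin powR_ge0.
rewrite -(cvg_lim _ H)//; apply/cvg_lim => //.
rewrite (_ : (fun _ => _) = fun i : nat => (b `^ k / k - (b / i.+2%:R) `^ k / k)%:E); last first.
  by apply/funext => i; rewrite /F integral_powR_itv// gt_eqF.
apply: cvg_EFin; first exact: nearW.
rewrite /comp/= -[X in _ --> X]subr0; apply: cvgB; first exact: cvg_cst.
rewrite -[0 in X in _ --> X](mul0r k^-1); apply: cvgMl.
apply: (@cvg_comp _ _ _ (fun i : nat => b / i.+2%:R) (fun x => x `^ k) _ (0^'+));
  last exact: powR_cvg0.
have H0 : b / i.+2%:R @[i --> \oo] --> 0.
  rewrite -(mulr0 b); apply: cvgMr.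
  by have := @cvg_harmonic R; rewrite -cvg_shiftS.
move=> P P0; have [N N0 HN] := H0 _ P0; exists N => // i Ni.
by apply: HN => //=; case/andP: (Fpos i).
Qed.

(** After multiplication by (1 - p)/2 the value is d^(1 - p), which tends to 1 for every fixed d:
    this is the concentration of the kernel at t = 0. *)
Lemma integral_normr_powR p d : 0 < d -> p < 1 ->
  (\int[mu]_t (\1_[set t | (`|t| <= d)%R] t * `|t| `^ (- p))%:E =
   (2 * d `^ (1 - p) / (1 - p))%:E)%E.
Proof.
move=> d0 p1.
set f : R -> \bar R := fun t => _.
have f0 t : (0 <= f t)%E by rewrite lee_fin mulr_ge0// powR_ge0.
have mD : measurable [set t : R | (`|t| <= d)%R].
  rewrite (_ : [set _ | _] = `[-d, d]%classic); first exact: measurable_itv.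
  by apply/seteqP; split=> t; rewrite /= in_itv/= ler_norml.
have mf : measurable_fun setT f.
  apply/measurable_EFinP; apply: measurable_funM; first exact: measurable_indic.
  by apply: (measurableT_comp (measurable_powR _)); exact: normr_measurable.
have fN t : f (- t) = f t.
  by rewrite /f normrN; congr (_ * _)%:E; rewrite !indicE; congr ((nat_of_bool _)%:R);
    apply/idP/idP; rewrite !inE/= normrN.
have E : (\int[mu]_(t in `[0%R, +oo[) f t = (d `^ (1 - p) / (1 - p))%:E)%E.
  rewrite -integral_itv_obnd_cbnd; last exact: measurable_funTS.
  rewrite -integral_powR_0b ?subr_gt0// integral_mkcond [RHS]integral_mkcond.
  apply: eq_integral => t _; rewrite !patchE !mem_setE !in_itv/= andbT /f.
  case: ifPn => t0; last by rewrite andFb.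
  rewrite indicE (gtr0_norm t0) addrAC subrr add0r.
  by case: ifPn => [td|td]; [rewrite mem_set ?mul1r//= gtr0_norm|
    rewrite memNset ?mul0r//= gtr0_norm//; exact/negP].
have TU : [set: R] = `]-oo, 0%R] `|` `]0%R, +oo[.
  apply/seteqP; split=> // t _ /=; rewrite !in_itv/= andbT.
  by case: (leP t 0); [left|right].
rewrite TU ge0_integral_setU//; last 2 first.
- exact: measurable_funTS.
- apply/disj_setPS => t /= []; rewrite !in_itv/= andbT => h1 h2.
  by move: (lt_le_trans h2 h1); rewrite ltxx.
rewrite integral_itv_obnd_cbnd; last exact: measurable_funTS.
have -> : (\int[mu]_(t in `]-oo, 0%R]) f t = \int[mu]_(t in `]-oo, 0%R]) f (- t)%R)%E.
  by apply: eq_integral => t _; rewrite fN.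
rewrite -(ge0_integration_by_substitution0 mf f0) E -EFinD; congr EFin.
by rewrite -mulrA mulr_natl mulr2n.
Qed.

End power_integrals.

(** * Spherical measure and integration along rays *)

Section sphere.
Context {R : realType} {n : nat}.

Definition punctured_ball : set 'rV[R]_n := [set x | 0 < enorm x <= 1].

Lemma measurable_punctured_ball : measurable punctured_ball.
Proof.
rewrite (_ : punctured_ball = enorm @^-1` `]0, 1]%classic); last first.
  by apply/seteqP; split=> x; rewrite /punctured_ball/= in_itv.
by apply: measurable_preimage => //; exact: measurable_enorm.
Qed.

Lemma direction_sphere (x : 'rV[R]_n) : x != 0 -> unit_sphere n (direction x).
Proof.
move=> x0; rewrite /unit_sphere/= /direction enormZ ger0_norm ?invr_ge0 ?enorm_ge0//.
by rewrite mulVf// enorm_eq0.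
Qed.

Lemma enorm_direction (x : 'rV[R]_n) : enorm x *: direction x = x.
Proof.
have [->|x0] := eqVneq x 0; first by rewrite enorm0 scale0r.
by rewrite /direction scalerA mulfV ?scale1r// enorm_eq0.
Qed.

Lemma directionZ (c : R) (x : 'rV[R]_n) : 0 < c -> direction (c *: x) = direction x.
Proof.
move=> c0; rewrite /direction enormZ gtr0_norm// scalerA invfM.
by rewrite mulrAC mulVf ?gt_eqF// mul1r.
Qed.

Lemma direction_unit (u : 'rV[R]_n) : unit_sphere n u -> direction u = u.
Proof. by rewrite /unit_sphere/= /direction => ->; rewrite invr1 scale1r. Qed.

Lemma integral_sphere (h : 'rV[R]_n -> \bar R) :
  measurable_fun setT h -> (forall x, 0 <= h x)%E ->
  (\int[spherical_measure n]_(u in unit_sphere n) h u =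
   n%:R%:E * \int[lebesgue_rV n]_(x in punctured_ball) h (direction x))%E.
Proof.
move=> mh h0; have mD := measurable_punctured_ball.
(* Outside the punctured ball [phi] is 0, a point off the sphere, so preimages of subsets of the
   sphere stay in the punctured ball and the spherical measure becomes n times a pushforward. *)
pose phi (x : 'rV[R]_n) : 'rV[R]_n := (\1_punctured_ball x) *: direction x.
have mphi : measurable_fun setT phi.
  apply: measurable_rVP => i; rewrite (_ : (fun _ => _) = fun t : 'rV[R]_n =>
    \1_punctured_ball t * direction t 0 i); last by apply/funext => t; rewrite mxE.
  apply: measurable_funM; first exact: measurable_indic.
  exact: (measurableT_comp (measurable_coord i) measurable_direction).
have mS : measurable (unit_sphere n : set 'rV[R]_n).
  rewrite (_ : unit_sphere n = enorm @^-1` [set 1 : R]) //.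
  by apply: measurable_preimage => //; exact: measurable_enorm.
have phiD x : punctured_ball x -> phi x = direction x.
  by move=> Dx; rewrite /phi indicE mem_set// scale1r.
have phiN x : ~ punctured_ball x -> phi x = 0.
  by move=> Dx; rewrite /phi indicE memNset// scale0r.
have DS : phi @^-1` unit_sphere n = punctured_ball.
  apply/seteqP; split=> x /=; last first.
    move=> Dx; rewrite phiD//; apply: direction_sphere.
    by move: Dx => /andP[]; rewrite enorm_gt0.
  have [//|Dx] := pselect (punctured_ball x).
  by rewrite phiN// /unit_sphere/= enorm0 => /eqP; rewrite eq_sym oner_eq0.
pose nu := measure_function_pushforward__canonical__measure_function_Measure
  (lebesgue_rV n) (mphi : measurable_fun setT phi).
pose nu2 : {measure set 'rV[R]_n -> \bar R} := mscale (NngNum (ler0n R n)) nu.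
rewrite (@eq_measure_integral _ _ _ _ nu2); last first.
  move=> A mA AS; rewrite /nu2 /mscale /= /spherical_measure /pushforward /=.
  congr (_ * lebesgue_rV n _)%E; apply/seteqP; split=> x /=.
    by move=> [Dx Ax]; rewrite phiD.
  move=> Ax; have [Dx|Dx] := pselect (punctured_ball x).
    by split => //; rewrite -phiD.
  by have := AS _ Ax; rewrite phiN// /unit_sphere/= enorm0 => /eqP; rewrite eq_sym oner_eq0.
have mhS := measurable_funTS (D := unit_sphere n) mh.
rewrite (ge0_integral_mscale _ mS _ mhS (fun x _ => h0 x)); congr (_ * _)%E.
rewrite (ge0_integral_pushforward mphi _ mS mhS (fun x _ => h0 x)) DS.
by apply: eq_integral => x; rewrite inE /= => /phiD ->.
Qed.

End sphere.

Section polar.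
Context {R : realType} {n : nat}.
Hypothesis n0 : (0 < n)%N.
Local Notation N := (n%:R : R).
Local Notation mu := (@lebesgue_measure R).

(* Fubini for (x, s) |-> N |x|^N s^(-N-1) 1(|x| <= s) f(x), whose integral in s
   is f(x), after the substitution of s x for x. *)
Lemma ge0_integral_polar (f : 'rV[R]_n -> R) :
  measurable_fun setT f -> (forall x, 0 <= f x) -> f 0 = 0 ->
  (\int[lebesgue_rV n]_x (f x)%:E =
   \int[lebesgue_rV n]_(x in punctured_ball)
     ((N * enorm x `^ N)%:E *
      \int[mu]_(s in `]0%R, +oo[) (s `^ (N - 1) * f (s *: x))%:E))%E.
Proof.
move=> mf f0 f00; have N0 : 0 < N by rewrite ltr0n.
have mD := @measurable_punctured_ball R n.
pose g (z : 'rV[R]_n * measurableTypeR R) : R :=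
  N * enorm z.1 `^ N * f z.1 * (z.2 `^ (- N - 1) * \1_[set z | 0 < enorm z.1 <= z.2] z).
pose h (z : 'rV[R]_n * measurableTypeR R) : R :=
  \1_punctured_ball z.1 * (N * enorm z.1 `^ N) *
   (z.2 `^ (N - 1) * f (z.2 *: z.1) * \1_`]0, +oo[%classic z.2).
have ge_g z : (0 <= (g z)%:E)%E by rewrite lee_fin !mulr_ge0 ?powR_ge0// ltW.
have ge_h z : (0 <= (h z)%:E)%E by rewrite lee_fin !mulr_ge0 ?powR_ge0// ltW.
have men1 : measurable_fun setT (fun z : 'rV[R]_n * measurableTypeR R => enorm z.1).
  exact: (measurableT_comp measurable_enorm).
have mset : measurable [set z : 'rV[R]_n * measurableTypeR R | 0 < enorm z.1 <= z.2].
  rewrite (_ : [set _ | _] = (fun z => enorm z.1) @^-1` `]0, +oo[ `&`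
     (fun z => z.2 - enorm z.1) @^-1` `[0, +oo[).
    apply: measurableI; apply: measurable_preimage => //.
    exact: measurable_funB.
  by apply/seteqP; split=> z; rewrite /= !in_itv/= !andbT subr_ge0 => /andP.
have mweight : measurable_fun setT
    (fun z : 'rV[R]_n * measurableTypeR R => N * enorm z.1 `^ N).
  apply: measurable_funM => //; exact: (measurableT_comp (measurable_powR _)).
have mg : measurable_fun setT (fun z => (g z)%:E).
  apply/measurable_EFinP; apply: measurable_funM.
    by apply: measurable_funM => //; exact: (measurableT_comp mf).
  apply: measurable_funM; last exact: measurable_indic.
  exact: (measurableT_comp (measurable_powR _)).
have mscl : measurable_fun setT (fun z : 'rV[R]_n * measurableTypeR R => z.2 *: z.1).
  apply: measurable_rVP => i; rewrite (_ : (fun _ => _) =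
    fun z : 'rV[R]_n * measurableTypeR R => z.2 * z.1 0 i); last first.
    by apply/funext => z; rewrite mxE.
  apply: measurable_funM => //; exact: (measurableT_comp (measurable_coord i)).
have mh : measurable_fun setT (fun z => (h z)%:E).
  apply/measurable_EFinP; apply: measurable_funM.
    apply: measurable_funM => //.
    exact: (measurableT_comp (measurable_indic mD)).
  apply: measurable_funM.
    apply: measurable_funM; last exact: (measurableT_comp mf).
    exact: (measurableT_comp (measurable_powR _)).
  by apply: (measurableT_comp (measurable_indic _)) => //; exact: measurable_itv.
transitivity (\int[lebesgue_rV n]_x \int[mu]_s (g (x, s))%:E)%E.
  apply: eq_integral => x _.
  have [->|x0] := eqVneq x 0.
    by rewrite f00; under eq_integral do rewrite /g/= f00 mulr0 mul0r; rewrite integral0.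
  have ex : 0 < enorm x by rewrite enorm_gt0.
  transitivity (\int[mu]_s ((N * enorm x `^ N * f x)%:E *
      ((fun s => (s `^ (- N - 1))%:E) \_ `[enorm x, +oo[) s))%E.
    rewrite ge0_integralTZl.
    - rewrite -integral_mkcond integral_powR_ay// -EFinM; congr EFin.
      by rewrite powRN; field; rewrite !gt_eqF ?powR_gt0.
    - by rewrite lee_fin !mulr_ge0 ?powR_ge0// ltW.
    - by move=> s; rewrite patchE; case: ifPn => // _; rewrite lee_fin powR_ge0.
    - apply/(measurable_restrictT _ (measurable_itv _)); apply: measurable_funTS.
      by apply/measurable_EFinP; exact: measurable_powR.
  apply: eq_integral => s _; rewrite /g/= patchE mem_setE in_itv/= andbT.
  rewrite indicE; case: ifPn => xs.
    by rewrite mem_set ?mulr1 -?EFinM//= ex.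
  by rewrite memNset ?mulr0 ?mule0//= ex => /andP[_]; apply/negP.
rewrite (fubini_tonelli _ mg ge_g).
transitivity (\int[mu]_s \int[lebesgue_rV n]_x (h (x, s))%:E)%E.
  apply: eq_integral => s _.
  have [s0|s0] := leP s 0.
    rewrite [LHS]integral0_eq; last first.
      move=> x _; rewrite /g/= indicE memNset ?mulr0//= => /andP[ex xs].
      by have := lt_le_trans ex xs; rewrite ltNge s0.
    rewrite integral0_eq// => x _; rewrite /h/= [\1_`]0, +oo[%classic _]indicE memNset ?mulr0//=.
    by rewrite in_itv/= andbT; apply/negP; rewrite -leNgt.
  have mgs : measurable_fun setT (fun x => (g (x, s))%:E).
    by apply: (measurableT_comp mg); exact: measurable_pair2.
  have := ge0_integral_rV_affine 0 s0 mgs (fun x => ge_g (x, s)).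
  have ms0 : measurable_fun setT (fun x : 'rV[R]_n => (g (s *: x + 0, s))%:E).
    exact: (measurableT_comp mgs (measurable_scale_shift _ _)).
  move=> /(congr1 (fun z => (s ^+ n)%:E * z)%E).
  rewrite muleA -EFinM mulfV ?gt_eqF ?exprn_gt0// mul1e => <-.
  rewrite -ge0_integralTZl//; last by rewrite lee_fin exprn_ge0// ltW.
  apply: eq_integral => x _; rewrite -EFinM; congr EFin; rewrite /g /h/= addr0.
  rewrite (_ : \1_[set z | _ < _ <= _] _ = \1_punctured_ball x); last first.
    rewrite !indicE; congr (_%:R); congr nat_of_bool; apply/idP/idP; rewrite !inE/=.
      rewrite enormZ gtr0_norm// pmulr_rgt0// => /andP[ex].
      by rewrite ger_pMr// => h1; apply/andP.
    by move=> /andP[ex h1]; rewrite enormZ gtr0_norm// pmulr_rgt0// ex ger_pMr.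
  rewrite [\1_`]0, +oo[%classic s]indicE mem_set/= ?in_itv/= ?s0//.
  rewrite enormZ gtr0_norm// powRM ?enorm_ge0 ?(ltW s0)//.
  rewrite -powR_mulrn ?ltW//.
  (* The first s^N is the Jacobian of x -> s x, the second comes from the homogeneity of |x|^N, and
     s^(-N - 1) is the weight in [g]. *)
  have -> : s `^ (N - 1) = s `^ N * (s `^ N * s `^ (- N - 1)).
    have sn0 : s != 0 by rewrite gt_eqF.
    rewrite -powRD ?sn0 ?implybT// -powRD ?sn0 ?implybT//.
    by congr (_ `^ _); ring.
  by ring.
rewrite -(fubini_tonelli _ mh ge_h) [RHS]integral_mkcond.
apply: eq_integral => x _; rewrite patchE; case: ifPn => Dx; last first.
  rewrite integral0_eq// => s _; rewrite /h/= indicE (negbTE Dx).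
  by rewrite !mul0r.
have mfx : measurable_fun setT (fun s : R => (s `^ (N - 1) * f (s *: x))%:E : \bar R).
  apply/measurable_EFinP; apply: measurable_funM; first exact: measurable_powR.
  apply: (measurableT_comp mf); apply: measurable_rVP => i.
  rewrite (_ : (fun _ => _) = fun s : R => s * x 0 i); first exact: measurable_funM.
  by apply/funext => s; rewrite mxE.
rewrite [in RHS]integral_mkcond -ge0_integralTZl.
- apply: eq_integral => s _; rewrite /h/= indicE Dx mul1r indicE patchE.
  by case: ifPn => _; rewrite ?mulr1 ?mulr0 ?mule0 -?EFinM.
- by rewrite lee_fin mulr_ge0 ?powR_ge0// ltW.
- by move=> s; rewrite patchE; case: ifPn => // _; rewrite lee_fin mulr_ge0 ?powR_ge0.
- by apply/(measurable_restrictT _ (measurable_itv _)); exact: measurable_funTS.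
Qed.

End polar.

Lemma invr_powR {R : realType} (a r : R) : 0 <= a -> a^-1 `^ r = a `^ (- r).
Proof. by move=> a0; rewrite -powR_inv1// -powRrM mulN1r. Qed.

Section star.
Context {R : realType} {n : nat}.
Hypothesis n0 : (0 < n)%N.
Local Notation N := (n%:R : R).
Local Notation mu := (@lebesgue_measure R).
Implicit Types rho : 'rV[R]_n -> R.

Lemma star_setE rho : (forall x, 0 <= rho x) ->
  star_set rho = [set x | enorm x <= rho (direction x)].
Proof.
move=> rho0; apply/seteqP; split=> x /=.
  move=> [u [t [uS /andP[t0 tu] ->]]].
  rewrite enormZ uS mulr1 ger0_norm//.
  have [->|tn0] := eqVneq t 0; first exact: rho0.
  by rewrite directionZ ?lt0r ?tn0// direction_unit.
(* Membership of the origin requires a unit vector u with 0 = 0 u, which exists because the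
   dimension is positive. *)
have [-> _|x0] := eqVneq x 0.
  pose e : 'rV[R]_n := const_mx 1.
  have e0 : e != 0.
    apply/eqP => /rowP/(_ (Ordinal n0)); rewrite !mxE => /eqP.
    by rewrite oner_eq0.
  exists (direction e), 0; rewrite scale0r; split => //; first exact: direction_sphere.
  by rewrite lexx rho0.
move=> h; exists (direction x), (enorm x); split.
- exact: direction_sphere.
- by rewrite enorm_ge0.
- by rewrite enorm_direction.
Qed.

Lemma measurable_star_set rho : (forall x, 0 <= rho x) ->
  measurable_fun setT rho -> measurable (star_set rho).
Proof.
move=> rho0 mrho; rewrite star_setE//.
rewrite (_ : [set _ | _] = (fun x => rho (direction x) - enorm x) @^-1` `[0, +oo[).
  apply: measurable_preimage => //; apply: measurable_funB.
    exact: (measurableT_comp mrho measurable_direction).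
  exact: measurable_enorm.
by apply/seteqP; split=> x; rewrite /= in_itv/= andbT subr_ge0.
Qed.

Lemma measurable_normr_dotr_powR p (v : 'rV[R]_n) :
  measurable_fun setT (fun x => `|dotr x v| `^ p).
Proof.
apply: (measurableT_comp (measurable_powR _)).
by apply: measurableT_comp => //; exact: measurable_dotr.
Qed.

(** Along each ray the integral of s^(N - p - 1) up to the boundary is proportional to rho^(N -
    p)/(N - p). The cosine transform thus becomes an integral over the star set of the kind that
    defines the L_p intersection body, and one limit theorem serves both stages. *)
Lemma integral_sphere_star rho p (v : 'rV[R]_n) : 0 < p < 1 ->
  (forall x, 0 <= rho x) -> measurable_fun setT rho ->
  (\int[spherical_measure n]_(u in unit_sphere n)
      (rho u `^ (N - p) * `|dotr v u| `^ (- p))%:E =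
   (N - p)%:E * \int[lebesgue_rV n]_x
      (\1_(star_set rho) x * `|dotr x v| `^ (- p))%:E)%E.
Proof.
move=> /andP[p0 p1] rho0 mrho.
have k0 : 0 < N - p by rewrite subr_gt0 (lt_le_trans p1)// ler1n.
have mL := measurable_star_set rho0 mrho.
pose f x : R := \1_(star_set rho) x * `|dotr x v| `^ (- p).
have mf : measurable_fun setT f.
  apply: measurable_funM; first exact: measurable_indic.
  exact: measurable_normr_dotr_powR.
have f0 x : 0 <= f x by rewrite mulr_ge0// powR_ge0.
have f00 : f 0 = 0.
  have d0 : dotr 0 v = 0 by rewrite -(scale0r 0) dotrZl mul0r.
  by rewrite /f d0 normr0 powR0 ?mulr0// oppr_eq0 gt_eqF.
rewrite [X in _ = (_ * X)%E](ge0_integral_polar n0 mf f0 f00).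
rewrite integral_sphere; last 2 first.
- apply/measurable_EFinP; apply: measurable_funM.
    exact: (measurableT_comp (measurable_powR _)).
  by under eq_fun do rewrite dotrC; exact: measurable_normr_dotr_powR.
- by move=> x; rewrite lee_fin mulr_ge0// powR_ge0.
have mD := @measurable_punctured_ball R n.
have mg : measurable_fun setT (fun x : 'rV[R]_n =>
    rho (direction x) `^ (N - p) * `|dotr v (direction x)| `^ (- p)).
  apply: measurable_funM.
    apply: (measurableT_comp (measurable_powR _)).
    exact: (measurableT_comp mrho measurable_direction).
  under eq_fun do rewrite dotrC.
  exact: (measurableT_comp (measurable_normr_dotr_powR _ _) measurable_direction).
have g0 (x : 'rV[R]_n) : 0 <= rho (direction x) `^ (N - p) * `|dotr v (direction x)| `^ (- p).
  by rewrite mulr_ge0// powR_ge0.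
transitivity (\int[lebesgue_rV n]_(x in punctured_ball) ((N - p)%:E * ((N / (N - p) *
    (rho (direction x) `^ (N - p) * `|dotr v (direction x)| `^ (- p)))%:E)))%E.
  rewrite -ge0_integralZl_EFin//.
  - by apply: eq_integral => x _; rewrite -!EFinM; congr EFin; field; rewrite gt_eqF.
  - by move=> x _; rewrite lee_fin.
  - by apply: measurable_funTS; exact/measurable_EFinP.
rewrite ge0_integralZl_EFin//; last 3 first.
- by move=> x _; rewrite lee_fin mulr_ge0// divr_ge0// ltW.
- by apply: measurable_funTS; apply/measurable_EFinP; exact: measurable_funM.
- exact: ltW.
congr (_ * _)%E; apply: eq_integral => x; rewrite inE => /andP[ex _].
have x0 : x != 0 by rewrite -enorm_gt0.
(* The vector x is not normalised, so the ray s x leaves the star set at s = rho/|x|. *)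
pose b := rho (direction x) / enorm x.
have -> : (\int[mu]_(s in `]0%R, +oo[) (s `^ (N - 1) * f (s *: x))%:E =
   \int[mu]_(s in `]0%R, b]) ((`|dotr x v| `^ (- p))%:E * (s `^ (N - p - 1))%:E))%E.
  rewrite integral_mkcond [RHS]integral_mkcond; apply: eq_integral => s _.
  rewrite !patchE !mem_setE !in_itv/= andbT; case: ifPn => s0; last by rewrite andFb.
  have -> : (s <= b) = (s *: x \in star_set rho).
    rewrite /b ler_pdivlMr// star_setE//; apply/idP/idP; rewrite inE/= directionZ//
      enormZ gtr0_norm//.
  rewrite /f indicE andTb; case: ifPn => _; last by rewrite mul0r mulr0.
  rewrite -EFinM mul1r dotrZl normrM (gtr0_norm s0) powRM// ?ltW//.
  have sn0 : s != 0 by rewrite gt_eqF.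
  rewrite mulrA -powRD ?sn0 ?implybT//.
  by rewrite mulrC; congr (_ * _ `^ _)%:E; ring.
have mpow : measurable_fun `]0%R, b]%classic (fun s : R => (s `^ (N - p - 1))%:E : \bar R).
  by apply: measurable_funTS; apply/measurable_EFinP; exact: measurable_powR.
have pow0 (s : R) : `]0%R, b]%classic s -> (0 <= (s `^ (N - p - 1))%:E)%E.
  by move=> _; rewrite lee_fin powR_ge0.
rewrite (@ge0_integralZl_EFin _ _ _ mu _ (measurable_itv _) _ pow0 mpow _ (powR_ge0 _ _)).
have [rho00|rhon0] := eqVneq (rho (direction x)) 0.
  rewrite /b rho00 mul0r powR0 ?gt_eqF// mul0r mulr0.
  rewrite [`]0, 0]%classic](_ : _ = set0) ?integral_set0 ?mule0//.
  by apply/seteqP; split=> s //=; rewrite in_itv/= => /andP[h1 h2];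
    move: (lt_le_trans h1 h2); rewrite ltxx.
have b0 : 0 < b by rewrite divr_gt0// lt0r rhon0 rho0.
rewrite integral_powR_0b// -!EFinM; congr EFin.
rewrite dotrC /direction dotrZl normrM normfV (gtr0_norm ex).
rewrite powRM ?invr_ge0 ?(ltW ex)// invr_powR ?(ltW ex)// opprK.
rewrite /b powRM ?invr_ge0 ?(ltW ex)// invr_powR ?(ltW ex)// opprB.
have -> : enorm x `^ N = enorm x `^ p * enorm x `^ (N - p).
  by rewrite -powRD ?(gt_eqF ex) ?implybT// addrC subrK.
have -> : enorm x `^ (p - N) = (enorm x `^ (N - p))^-1 by rewrite -powRN opprB.
by field; rewrite !gt_eqF// powR_gt0.
Qed.

End star.

(** * Asymptotics of the cosine integrals of a thick set *)

Section thick.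
Context {R : realType} {m : nat}.
Implicit Types (L : set 'rV[R]_m.+1) (u v : 'rV[R]_m.+1) (B : 'M[R]_(m, m.+1)).

(* The last clause says that the d-neighbourhood of L lies in (1 + e) L. *)
Definition thick L := [/\ measurable L,
  exists2 a, 0 < a & eball m.+1 a `<=` L,
  exists2 b, 0 < b & L `<=` eball m.+1 b &
  forall e, 0 < e -> exists2 d, 0 < d & forall x y, L x -> enorm (x - y) <= d ->
    L ((1 + e)^-1 *: y)].

Definition section_volume L u := hyperplane_volume u (L `&` hyperplane u).

Lemma measurable_section L B : measurable L -> measurable [set y | L (y *m B)].
Proof. by move=> mL; exact: (measurable_preimage (measurable_mulmx B)). Qed.

Lemma section_volume_le (L : set 'rV[R]_m.+1) B (b : R) : 0 < b -> measurable L ->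
  B *m B^T = 1%:M -> L `<=` eball m.+1 b ->
  (lebesgue_rV m [set y | L (y *m B)] <= lebesgue_rV m (eball m b))%E.
Proof.
move=> b0 mL BB Lb; apply: le_measure; rewrite ?inE.
- exact: measurable_section.
- exact: measurable_enorm_le.
- by move=> y /= /Lb; rewrite /eball/= enorm_mulmx.
Qed.

(** Sections of a set contained in a ball have finite volume, so [fine] loses nothing, and any frame
    may stand for the chosen one. *)
Lemma section_volumeE L u B : thick L -> unit_sphere m.+1 u -> is_frame u B ->
  (section_volume L u)%:E = lebesgue_rV m [set y | L (y *m B)].
Proof.
move=> [mL _ [b b0 Lb] _] uS uB; have [BB _] := uB.
have uF := hyperplane_frameP uS.
rewrite /section_volume /hyperplane_volume.
have -> : [set y : 'rV[R]_m.+1.-1 | (L `&` hyperplane u) (y *m hyperplane_frame u)] =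
    [set y | L (y *m hyperplane_frame u)].
  apply/seteqP; split=> y /= => [[]//|Ly]; split => //.
  exact: frame_dotr.
rewrite -(frame_volume uS uB uF mL) fineK// ge0_fin_numE//.
have [w [_ wE]] := @lebesgue_ball_bounds R m b b0.
by rewrite (le_lt_trans (section_volume_le b0 mL BB Lb))// wE ltry.
Qed.

Lemma section_volume_gt0 L : thick L ->
  exists2 c, 0 < c & forall u, unit_sphere m.+1 u -> c <= section_volume L u.
Proof.
move=> tL; have [mL [a a0 aL] _ _] := tL.
have [w [w0 wE]] := @lebesgue_ball_bounds R m a a0.
exists w => // u uS; have uF := hyperplane_frameP uS; have [BB _] := uF.
rewrite -lee_fin (section_volumeE tL uS uF) -wE.
apply: le_measure; rewrite ?inE.
- exact: measurable_enorm_le.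
- exact: measurable_section.
- by move=> y /= ya; apply: aL; rewrite /eball/= enorm_mulmx.
Qed.

Lemma section_volume_bounded L : thick L ->
  exists2 c, 0 < c & forall u, unit_sphere m.+1 u -> section_volume L u <= c.
Proof.
move=> tL; have [mL _ [b b0 Lb] _] := tL.
have [w [w0 wE]] := @lebesgue_ball_bounds R m b b0.
exists w => // u uS; have uF := hyperplane_frameP uS; have [BB _] := uF.
rewrite -lee_fin (section_volumeE tL uS uF) -wE.
exact: section_volume_le.
Qed.

Lemma section_volume_dilate L u B (c : R) : thick L -> unit_sphere m.+1 u ->
  is_frame u B -> 0 < c ->
  lebesgue_rV m [set y | L (c *: (y *m B))] = (c ^- m * section_volume L u)%:E.
Proof.
move=> tL uS uB c0; rewrite EFinM (section_volumeE tL uS uB).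
have mLB : measurable [set y | L (y *m B)] by apply: measurable_section; case: tL.
rewrite -(lebesgue_rV_affine 0 c0 mLB); congr (lebesgue_rV m _).
by apply/seteqP; split=> y /=; rewrite addr0 scalemxAl.
Qed.

Lemma measurable_slab (L : set 'rV[R]_m.+1) v (c d p : R) : measurable L ->
  measurable_fun setT (fun x : 'rV[R]_m.+1 =>
    (\1_[set t | `|t| <= d] (dotr x v) * `|dotr x v| `^ (- p) *
      \1_L (c *: (x - dotr x v *: v)))%:E : \bar R).
Proof.
move=> mL.
have mI : measurable [set t : measurableTypeR R | `|t| <= d].
  rewrite (_ : [set _ | _] = `[-d, d]%classic); first exact: measurable_itv.
  by apply/seteqP; split=> t; rewrite /= in_itv/= ler_norml.
have mproj : measurable_fun setT (fun x : 'rV[R]_m.+1 => c *: (x - dotr x v *: v)).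
  apply: measurable_rVP => i; rewrite (_ : (fun _ => _) = fun x : 'rV[R]_m.+1 =>
    c * (x 0 i - dotr x v * v 0 i)); last by apply/funext => x; rewrite !mxE.
  apply: measurable_funM => //; apply: measurable_funB; first exact: measurable_coord.
  by apply: measurable_funM => //; exact: measurable_dotr.
apply/measurable_EFinP; apply: measurable_funM.
  apply: measurable_funM; last exact: measurable_normr_dotr_powR.
  exact: (measurableT_comp (measurable_indic mI) (measurable_dotr v)).
exact: (measurableT_comp (measurable_indic mL) mproj).
Qed.

(** The integrand lives on a cylinder: the section of L dilated by 1/c, times the interval |t| <= d
    along v. There the integral factorises exactly, which makes it the comparison function for both
    the upper and the lower bound on the integral over L. *)
Lemma integral_slab L v (c d p : R) : thick L -> unit_sphere m.+1 v ->
  0 < c -> 0 < d -> p < 1 ->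
  (\int[lebesgue_rV m.+1]_x
     (\1_[set t | `|t| <= d] (dotr x v) * `|dotr x v| `^ (- p) *
      \1_L (c *: (x - dotr x v *: v)))%:E =
   (2 * d `^ (1 - p) / (1 - p) * (c ^- m * section_volume L v))%:E)%E.
Proof.
move=> tL vS c0 d0 p1; have [B vF] := exists_frame vS.
have mL : measurable L by case: tL.
rewrite (ge0_integral_slices vS vF (measurable_slab v c d p mL)); last first.
  by move=> x; rewrite lee_fin !mulr_ge0// powR_ge0.
have mLc : measurable [set y : 'rV[R]_m | L (c *: (y *m B))].
  rewrite (_ : [set _ | _] = (fun y : 'rV[R]_m => c *: y + 0) @^-1` [set y | L (y *m B)]).
    apply: measurable_preimage; first exact: measurable_scale_shift.
    exact: measurable_section.
  by apply/seteqP; split=> y /=; rewrite addr0 scalemxAl.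
transitivity (\int[lebesgue_measure]_t
   ((c ^- m * section_volume L v)%:E * (\1_[set t | `|t| <= d] t * `|t| `^ (- p))%:E))%E.
  apply: eq_integral => t _.
  transitivity (\int[lebesgue_rV m]_y ((\1_[set t | `|t| <= d] t * `|t| `^ (- p))%:E *
    (\1_[set y : 'rV[R]_m | L (c *: (y *m B))] y)%:E))%E.
    apply: eq_integral => y _; rewrite -EFinM; congr EFin.
    have -> : dotr (t *: v + y *m B) v = t.
      by rewrite dotrDl dotrZl unit_sphere_dotr// mulr1 frame_dotr// addr0.
    by rewrite addrAC subrr add0r; congr (_ * _); rewrite !indicE; congr (_%:R);
      congr nat_of_bool; apply/idP/idP; rewrite !inE.
  rewrite ge0_integralTZl.
  - rewrite [RHS]muleC; congr (_ * _)%E; rewrite (integral_indic_set _ mLc).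
    exact: section_volume_dilate.
  - by rewrite lee_fin mulr_ge0// powR_ge0.
  - exact: EFin_indic_ge0.
  - exact: measurable_fun_EFin_indic.
have [w w0 wL] := section_volume_gt0 tL.
rewrite ge0_integralTZl.
- by rewrite integral_normr_powR// -EFinM mulrC.
- by rewrite lee_fin mulr_ge0 ?invr_ge0 ?exprn_ge0 ?(ltW c0)// (le_trans (ltW w0))// wL.
- by move=> t; rewrite lee_fin mulr_ge0// powR_ge0.
- apply/measurable_EFinP; apply: measurable_funM.
    apply: measurable_indic; rewrite (_ : [set _ | _] = `[-d, d]%classic).
      exact: measurable_itv.
    by apply/seteqP; split=> t; rewrite /= in_itv/= ler_norml.
  by apply: (measurableT_comp (measurable_powR _)); exact: normr_measurable.
Qed.

End thick.

Lemma near_left1 {R : realType} (P : R -> Prop) (eta : R) : 0 < eta ->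
  (forall p, 0 < p < 1 -> 1 - p < eta -> P p) -> \forall p \near 1^'-, P p.
Proof.
move=> eta0 H; near=> p; apply: H.
  apply/andP; split; near: p; first exact: nbhs_left_gt.
  exact: nbhs_left_lt.
by rewrite ltrBlDl -ltrBlDr; near: p; apply: nbhs_left_gt; rewrite ltrBlDr ltrDl.
Unshelve. all: by end_near. Qed.

(* F p and H p are asymptotically equal as p -> 1-, uniformly on the sphere, up to
   multiplicative errors; such errors survive integration over any domain. *)
Definition mequiv {R : realType} n (F H : R -> 'rV[R]_n -> R) :=
  forall e, 0 < e -> \forall p \near 1^'-, forall u, unit_sphere n u ->
    F p u <= expR e * H p u /\ H p u <= expR e * F p u.

Section asymptotics.
Context {R : realType} {m : nat}.
Implicit Types (L : set 'rV[R]_m.+1) (u v : 'rV[R]_m.+1).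

(** For a unit vector v, the power 1/p of this quantity is the radial function of
    [Lp_intersection_body p L] at v. *)
Definition cosine_volume L (p : R) v : R :=
  (1 - p) / 2 * \int[lebesgue_rV m.+1]_(y in L) `|dotr v y| `^ (- p).

Let weight L p v (x : 'rV[R]_m.+1) : R := \1_L x * `|dotr x v| `^ (- p).

Let measurable_weight L p v : measurable L ->
  measurable_fun setT (fun x => (weight L p v x)%:E).
Proof.
move=> mL; apply/measurable_EFinP; apply: measurable_funM; first exact: measurable_indic.
exact: measurable_normr_dotr_powR.
Qed.

Let slab_ge0 (L : set 'rV[R]_m.+1) v (c d p : R) (x : 'rV[R]_m.+1) :
  (0 <= (\1_[set t | (`|t| <= d)%R] (dotr x v) * `|dotr x v| `^ (- p) *
      \1_L (c *: (x - dotr x v *: v))%R)%:E)%E.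
Proof. by rewrite lee_fin !mulr_ge0// powR_ge0. Qed.

Lemma thick_lebesgue L : thick L ->
  exists2 W, 0 <= W & lebesgue_rV m.+1 L = W%:E.
Proof.
move=> [mL _ [b b0 Lb] _].
have [w [w0 wE]] := @lebesgue_ball_bounds R m.+1 b b0.
have Lfin : (lebesgue_rV m.+1 L <= w%:E)%E.
  by rewrite -wE; apply: le_measure; rewrite ?inE//; exact: measurable_enorm_le.
have L0 : (0 <= lebesgue_rV m.+1 L)%E by exact: measure_ge0.
exists (fine (lebesgue_rV m.+1 L)); first exact: fine_ge0.
by rewrite fineK// ge0_fin_numE// (le_lt_trans Lfin)// ltry.
Qed.

Lemma enorm_proj v x : unit_sphere m.+1 v ->
  enorm (x - (x - dotr x v *: v)) = `|dotr x v|.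
Proof. by move=> vS; rewrite subKr enormZ vS mulr1. Qed.

(** If x in L has |x.v| <= d, its projection to v^perp is within d of x, hence in (1 + e) L, and the
    cylinder over the dilated section takes over. The rest of L has kernel at most 1/d and
    contributes at most W/d, which the factor (1 - p)/2 later kills. *)
Lemma cosine_integral_le L e W : thick L -> 0 < e -> lebesgue_rV m.+1 L = W%:E ->
  exists2 d, 0 < d <= 1 & forall p v, 0 < p < 1 -> unit_sphere m.+1 v ->
  (\int[lebesgue_rV m.+1]_x (\1_L x * `|dotr x v| `^ (- p))%:E <=
   (2 / (1 - p) * ((1 + e) ^+ m * section_volume L v) + d^-1 * W)%:E)%E.
Proof.
move=> tL e0 LW; have [mL _ _ LP] := tL; have [d' d'0 Ld'] := LP _ e0.
(* The bound d <= 1 gives both d^-p <= 1/d and d^(1 - p) <= 1. *)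
pose d := Num.min d' 1.
have d0 : 0 < d by rewrite lt_min d'0 ltr01.
have d1 : d <= 1 by rewrite ge_min lexx orbT.
exists d => [|p v /andP[p0 p1] vS]; first by rewrite d0.
have e1 : 0 < 1 + e by rewrite addr_gt0.
have e1' : 0 < (1 + e)^-1 by rewrite invr_gt0.
pose F (x : 'rV[R]_m.+1) : R :=
  \1_[set t | `|t| <= d] (dotr x v) * `|dotr x v| `^ (- p) *
      \1_L ((1 + e)^-1 *: (x - dotr x v *: v)).
have mF : measurable_fun setT (fun x => (F x)%:E) by exact: measurable_slab.
have F0 x : (0 <= (F x)%:E)%E by exact: slab_ge0.
have mI := @measurable_fun_EFin_indic R _ _ _ mL.
have dI0 : (0 <= d^-1%:E)%E by rewrite lee_fin invr_ge0 ltW.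
have mdI : measurable_fun setT (fun x => d^-1%:E * (\1_L x)%:E : \bar R)%E.
  by apply: emeasurable_funM => //; exact: measurable_cst.
have dIx x : (0 <= d^-1%:E * (\1_L x)%:E)%E by rewrite mule_ge0// EFin_indic_ge0.
apply: (@le_trans _ _ (\int[lebesgue_rV m.+1]_x ((F x)%:E + (d^-1)%:E * (\1_L x)%:E))%E).
  apply: ge0_le_integral => //.
  - exact: (measurable_weight p v mL).
  - exact: emeasurable_funD.
  - move=> x _; rewrite -EFinM -EFinD lee_fin /F.
    have [Lx|Lx] := pselect (L x); last first.
      rewrite indicE (memNset Lx) mul0r mulr0 addr0.
      by have := F0 x; rewrite lee_fin.
    rewrite indicE (mem_set Lx) mul1r mulr1.
    have [xd|xd] := leP `|dotr x v| d.
      rewrite indicE mem_set// mul1r.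
      rewrite indicE mem_set ?mulr1; last first.
        apply: (Ld' x) => //; rewrite enorm_proj//.
        by rewrite (le_trans xd)// /d ge_min lexx.
      by rewrite lerDl invr_ge0 ltW.
    rewrite [\1_[set t | _] _]indicE memNset/=; last by apply/negP; rewrite -ltNge.
    have x0 := lt_trans d0 xd.
    rewrite !mul0r add0r powRN lef_pV2 ?posrE ?powR_gt0//.
    apply: (@le_trans _ _ (d `^ p)).
      by rewrite ger1_powR// ?d0//= ltW.
    by apply: ge0_ler_powR; rewrite ?nnegrE ?(ltW p0) ?(ltW d0)// ltW.
rewrite ge0_integralD//.
rewrite (ge0_integralTZl _ dI0 (EFin_indic_ge0 L) mI).
rewrite (integral_indic_set _ mL).
rewrite (integral_slab tL vS e1' d0 p1).
rewrite [X in (_ + _ * X)%E]LW -EFinM -EFinD lee_fin lerD2r.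
rewrite exprVn invrK.
have [c c0 cL] := section_volume_gt0 tL.
rewrite ler_wpM2r//.
  by rewrite mulr_ge0 ?exprn_ge0 ?(ltW e1)// (le_trans (ltW c0))// cL.
rewrite ler_wpM2r ?invr_ge0 ?subr_ge0 ?(ltW p1)//.
rewrite ler_piMr//.
have : d `^ (1 - p) <= 1 `^ (1 - p).
  by apply: ge0_ler_powR; rewrite ?nnegrE ?subr_ge0 ?(ltW p1) ?(ltW d0).
by rewrite powR1.
Qed.

(** Conversely, if (1 + e) times the projection of x lies in L and |x.v| <= d, then (1 + e) x is
    within (1 + e) d of it, so thickness puts x in L. This is why d' is divided by 1 + e. *)
Lemma cosine_integral_ge L e : thick L -> 0 < e ->
  exists2 d, 0 < d <= 1 & forall p v, 0 < p < 1 -> unit_sphere m.+1 v ->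
  ((2 * d `^ (1 - p) / (1 - p) * ((1 + e) ^- m * section_volume L v))%:E <=
  \int[lebesgue_rV m.+1]_x (\1_L x * `|dotr x v| `^ (- p))%:E)%E.
Proof.
move=> tL e0; have [mL _ _ LP] := tL; have [d' d'0 Ld'] := LP _ e0.
have e1 : 0 < 1 + e by rewrite addr_gt0.
pose d := Num.min (d' / (1 + e)) 1.
have d0 : 0 < d by rewrite lt_min ltr01 divr_gt0.
have d1 : d <= 1 by rewrite ge_min lexx orbT.
exists d => [|p v /andP[p0 p1] vS]; first by rewrite d0.
rewrite -(integral_slab tL vS e1 d0 p1).
apply: ge0_le_integral => //.
- exact: measurable_slab.
- exact: (measurable_weight p v mL).
- move=> x _; rewrite lee_fin.
  have [xd|xd] := leP `|dotr x v| d; last first.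
    rewrite [\1_[set t | _] _]indicE memNset/=; last by apply/negP; rewrite -ltNge.
    by rewrite !mul0r mulr_ge0// powR_ge0.
  rewrite [\1_[set t | _] _]indicE mem_set// mul1r mulrC ler_wpM2r ?powR_ge0//.
  rewrite indicE; have [/set_mem Lx|_] := boolP (_ \in L); last by rewrite ler0n.
  rewrite indicE mem_set//.
  have := Ld' _ ((1 + e) *: x) Lx.
  rewrite scalerA mulVf ?gt_eqF// scale1r; apply.
  rewrite -scalerBr enormZ (gtr0_norm e1) enormB enorm_proj// mulrC -ler_pdivlMr//.
  by rewrite (le_trans xd)// /d ge_min lexx.
Qed.

End asymptotics.

Section cosine_volume_limit.
Context {R : realType} {m : nat}.
Implicit Types (L : set 'rV[R]_m.+1) (u v : 'rV[R]_m.+1).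

(** The upper bound of [cosine_integral_le] makes the extended integral finite, so it can be
    recovered from the real-valued one. *)
Lemma cosine_volumeE L p v : thick L -> 0 < p < 1 -> unit_sphere m.+1 v ->
  (\int[lebesgue_rV m.+1]_x (\1_L x * `|dotr x v| `^ (- p))%:E =
   (2 / (1 - p) * cosine_volume L p v)%:E)%E.
Proof.
move=> tL p01 vS; have [W W0 LW] := thick_lebesgue tL.
have [d _ /(_ p v p01 vS) H] := cosine_integral_le tL ltr01 LW.
set I := (\int[_]_x _)%E in H *.
have I0 : (0 <= I)%E.
  by apply: integral_ge0 => x _; rewrite lee_fin mulr_ge0// powR_ge0.
have Ifin : I \is a fin_num by rewrite ge0_fin_numE// (le_lt_trans H)// ltry.
have -> : cosine_volume L p v = (1 - p) / 2 * fine I.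
  rewrite /cosine_volume /Rintegral; congr (_ * fine _).
  rewrite integral_mkcond; apply: eq_integral => x _.
  rewrite patchE indicE dotrC; case: ifPn => _; first by rewrite mul1r.
  by rewrite mul0r.
have [_ p1] := andP p01.
have -> : 2 / (1 - p) * ((1 - p) / 2 * fine I) = fine I.
  by field; rewrite gt_eqF// subr_gt0.
by rewrite fineK.
Qed.

Lemma mequiv_cosine_volume L : thick L ->
  mequiv (cosine_volume L) (fun _ => section_volume L).
Proof.
move=> tL e e0; have [W W0 LW] := thick_lebesgue tL.
have [c c0 cL] := section_volume_gt0 tL.
(* Half of e is spent on the dilation factor, (1 + t)^m <= e^(e/2); the other half is left for the
   remainder W/d1 or for the factor d2^(1 - p). *)
pose t := e / 2 / m.+1%:R.
have t0 : 0 < t by rewrite !divr_gt0.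
have t1 : 0 < 1 + t by rewrite addr_gt0.
have tm : (1 + t) ^+ m <= expR (e / 2).
  apply: (@le_trans _ _ (expR t ^+ m)).
    by rewrite lerXn2r ?nnegrE ?expR_ge0 ?(ltW t1)// expR_ge1Dx.
  rewrite -expRM_natl ler_expR /t mulrA ler_pdivrMr// mulrC.
  by rewrite ler_wpM2l ?ler_nat// divr_ge0// ltW.
have [d1 /andP[d10 d11] up] := cosine_integral_le tL t0 LW.
have [d2 /andP[d20 d21] lo] := cosine_integral_ge tL t0.
have ee : 0 < expR e - expR (e / 2).
  by rewrite subr_gt0 ltr_expR ltr_pdivrMr// ltr_pMr// ltr1n.
(* For 1 - p < eta1 the additive remainder (1 - p)/2 W/d1 is below (e^e - e^(e/2)) c. The uniform
   lower bound c on section volumes makes it a multiplicative error; W + 1 avoids a zero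
   denominator. *)
pose eta1 := 2 * ((expR e - expR (e / 2)) * c * d1) / (W + 1).
have eta10 : 0 < eta1 by rewrite divr_gt0 ?mulr_gt0// ltr_wpDl.
(* For 1 - p < eta2 one has d2^(1 - p) >= e^(-e/2); the added 1 keeps the denominator positive when
   d2 = 1. *)
pose eta2 := e / 2 / (1 - ln d2).
have ln0 : 0 < 1 - ln d2 by rewrite ltr_pwDl// oppr_ge0 ln_le0.
have eta20 : 0 < eta2 by rewrite !divr_gt0.
have eta0 : 0 < Num.min eta1 eta2 by rewrite lt_min eta10.
apply: (near_left1 eta0) => p p01; rewrite lt_min => /andP[h1 h2] v vS.
have [p0 p1] := andP p01.
have q0 : 0 < 1 - p by rewrite subr_gt0.
have V0 : 0 < section_volume L v by apply: lt_le_trans (cL _ vS).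
set V := section_volume L v in V0 *; set G := cosine_volume L p v.
have GE := cosine_volumeE tL p01 vS.
split.
  have := up p v p01 vS; rewrite GE lee_fin -/G -/V => H.
  have {}H : G <= (1 + t) ^+ m * V + (1 - p) / 2 * (d1^-1 * W).
    have := ler_wpM2l (ltW (divr_gt0 q0 (ltr0n R 2))) H.
    rewrite mulrDr !mulrA (_ : (1 - p) / 2 * 2 / (1 - p) = 1) ?mul1r//.
    by field; rewrite gt_eqF.
  apply: (le_trans H).
  apply: (@le_trans _ _ (expR (e / 2) * V + (expR e - expR (e / 2)) * V)); last first.
    by rewrite -mulrDl addrC subrK.
  apply: lerD; first by rewrite ler_wpM2r// ltW.
  apply: (@le_trans _ _ ((expR e - expR (e / 2)) * c)).
    move: h1; rewrite /eta1 ltr_pdivlMr ?ltr_wpDl// => h1.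
    rewrite mulrCA mulrC ler_pdivrMr//.
    have : (1 - p) * W <= (1 - p) * (W + 1) by rewrite ler_wpM2l ?(ltW q0)// lerDl.
    lra.
  by rewrite ler_wpM2l ?(ltW ee)// cL.
have := lo p v p01 vS; rewrite GE lee_fin -/G -/V => H.
have {}H : d2 `^ (1 - p) * ((1 + t) ^- m * V) <= G.
  have := ler_wpM2l (ltW (divr_gt0 q0 (ltr0n R 2))) H.
  set X := (1 + t) ^- m * V.
  rewrite (_ : (1 - p) / 2 * (2 * d2 `^ (1 - p) / (1 - p) * X) = d2 `^ (1 - p) * X).
    rewrite (_ : (1 - p) / 2 * (2 / (1 - p) * G) = G)//.
    by field; rewrite gt_eqF.
  by field; rewrite gt_eqF.
have D0 : 0 < d2 `^ (1 - p) by rewrite powR_gt0.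
have tm0 : 0 < (1 + t) ^+ m by rewrite exprn_gt0.
have G0 : 0 <= G.
  by apply: le_trans H; rewrite !mulr_ge0 ?invr_ge0 ?(ltW tm0) ?(ltW D0) ?(ltW V0).
have {}H : V <= (1 + t) ^+ m * (d2 `^ (1 - p))^-1 * G.
  rewrite -ler_pdivrMl ?mulr_gt0 ?invr_gt0//.
  by apply: le_trans H; rewrite invfM invrK mulrCA mulrA.
apply: (le_trans H).
rewrite ler_wpM2r//.
rewrite (splitr e) expRD ler_pM ?invr_ge0 ?(ltW D0) ?(ltW tm0)//.
rewrite -powRN /powR gt_eqF// ler_expR.
move: h2; rewrite /eta2 ltr_pdivlMr// => /ltW h2; apply: le_trans h2.
by rewrite mulNr -mulrN ler_wpM2l ?(ltW q0)// lerDr.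
Qed.

End cosine_volume_limit.

(** * Convex bodies and star bodies *)

Section bodies.
Context {R : realType} {m : nat}.
Implicit Types (K L : set 'rV[R]_m.+1) (u v w x y : 'rV[R]_m.+1).

(** Here [ball] refers to the maximum norm; m + 1 is a crude bound for the square root of the
    dimension. *)
Lemma enorm_ball x y (e : R) : ball x e y -> enorm (x - y) <= m.+1%:R * e.
Proof.
move=> [e0 xy].
have H i : `|(x - y) 0 i| <= e by rewrite !mxE ltW//; exact: (xy 0 i).
rewrite -ler_sqr ?nnegrE ?enorm_ge0 ?mulr_ge0 ?(ltW e0)// enorm_sqr.
apply: (@le_trans _ _ (\sum_(i < m.+1) e ^+ 2)).
  apply: ler_sum => i _; rewrite -expr2 -[_ ^+ 2]real_normK ?num_real//.
  by rewrite ler_sqr ?nnegrE ?(ltW e0).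
rewrite sumr_const card_ord -[leLHS]mulr_natl exprMn ler_wpM2r ?sqr_ge0//.
by rewrite -natrX ler_nat -[leqLHS]muln1 -mulnn leq_mul.
Qed.

Lemma ball_enorm x y (e : R) : enorm (x - y) < e -> ball x e y.
Proof.
move=> xy; split; first exact: le_lt_trans (enorm_ge0 _) xy.
move=> i j; rewrite (ord1 i); apply: le_lt_trans xy.
by have := coord_le_enorm (x - y) j; rewrite !mxE.
Qed.

(** If K contains the ball of radius r about the origin and |x - y| <= e r, then y = x + e z with z
    in K, and y/(1 + e) is a convex combination of x and z. *)
Lemma convex_body_thick K : convex_body_o K -> thick K.
Proof.
move=> [cK vK iK].
have clK : closed K by apply: compact_closed => //; exact: norm_hausdorff.
have mK : measurable K.
  rewrite -[K]setCK; apply: measurableC; apply: sub_sigma_algebra.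
  by rewrite openC.
have [e0 e00 eK] : exists2 e, 0 < e & ball 0 e `<=` K.
  by move: iK => /nbhs_ballP [e /= e0 eK]; exists e.
have aK : eball m.+1 (e0 / 2) `<=` K.
  move=> x xe; apply: eK; apply: ball_enorm; rewrite sub0r enormN.
  by apply: le_lt_trans xe _; rewrite ltr_pdivrMr// ltr_pMr// ltr1n.
have a0 : 0 < e0 / 2 by rewrite divr_gt0.
have [b b0 Kb] : exists2 b, 0 < b & K `<=` eball m.+1 b.
  have [M [_ /(_ (Num.max M 0 + 1)) HM]] := compact_bounded cK.
  pose c := Num.max M 0 + 1.
  have c0 : 0 < c by rewrite /c addrC ltr_pwDl// le_max lexx orbT.
  exists (m.+1%:R * (c + 1)); first by rewrite mulr_gt0// addr_gt0.
  move=> x Kx; rewrite /eball/= -[x]opprK enormN -[- x]sub0r.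
  apply: enorm_ball; rewrite mx_norm_ball /ball_/= sub0r normrN.
  apply: (@le_lt_trans _ _ c); last by rewrite ltrDl.
  by apply: HM => //; rewrite /c -[ltLHS]addr0 ler_ltD// le_max lexx.
split => //; [by exists (e0 / 2)|by exists b|].
move=> e e1; exists (e * (e0 / 2)); first by rewrite mulr_gt0.
move=> x y Kx xy.
pose z := e^-1 *: (y - x).
have Kz : K z.
  apply: aK; rewrite /eball/= enormZ gtr0_norm ?invr_gt0// enormB.
  by rewrite ler_pdivrMl.
have e10 : 0 < 1 + e by rewrite addr_gt0.
have l01 : 0 <= (1 + e)^-1 <= 1.
  by rewrite invr_ge0 (ltW e10)/= invf_le1// lerDl ltW.
have := vK x z (Itv01 (proj1 (andP l01)) (proj2 (andP l01))) (mem_set Kx) (mem_set Kz).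
rewrite inE; congr K.
rewrite /conv/= /z scalerA /unstable.onem.
have -> : (1 - (1 + e)^-1) * e^-1 = (1 + e)^-1.
  by field; rewrite !gt_eqF.
by rewrite -scalerDr (addrC x) subrK.
Qed.

Lemma radial_function_bounds K : thick K ->
  exists ab : R * R, 0 < ab.1 /\
    forall u, unit_sphere m.+1 u -> ab.1 <= radial_function K u <= ab.2.
Proof.
move=> [mK [a a0 aK] [b b0 Kb] _]; exists (a, b); split => //= u uS.
have ub : ubound [set t | 0 <= t /\ K (t *: u)] b.
  by move=> t [t0 /Kb]; rewrite /eball/= enormZ uS mulr1 ger0_norm.
have aT : [set t | 0 <= t /\ K (t *: u)] a.
  split; first exact: ltW.
  by apply: aK; rewrite /eball/= enormZ uS mulr1 gtr0_norm.
apply/andP; split; last by apply: ge_sup => //; exists a.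
by apply: sup_ubound => //; exists b.
Qed.

Lemma star_radial_function (rho : 'rV[R]_m.+1 -> R) u : unit_sphere m.+1 u ->
  0 <= rho u -> radial_function (star_set rho) u = rho u.
Proof.
move=> uS rho0.
have ub : ubound [set t | 0 <= t /\ star_set rho (t *: u)] (rho u).
  move=> t [t0 [w [s [wS /andP[s0 sw] tE]]]].
  have ts : t = s.
    by have := congr1 enorm tE; rewrite !enormZ uS wS !mulr1 !ger0_norm.
  have [t00|tn0] := eqVneq t 0; first by rewrite t00.
  have -> : u = w.
    by have := congr1 (fun z => t^-1 *: z) tE; rewrite -ts !scalerA mulVf// !scale1r.
  by rewrite ts.
apply/eqP; rewrite eq_le; apply/andP; split.
  apply: ge_sup.
    by exists 0; split => //; exists u, 0; rewrite lexx rho0.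
  exact: ub.
apply: sup_ubound; first by exists (rho u).
by split => //; exists u, (rho u); rewrite lexx rho0.
Qed.

(* On the hyperplane u^perp, the reflection in (u + w)^perp, which maps it onto
   w^perp, is close to the identity when w is close to u. *)
Lemma section_volume_continuous K : thick K -> forall e, 0 < e ->
  exists2 d, 0 < d & forall u w, unit_sphere m.+1 u -> unit_sphere m.+1 w ->
    enorm (u - w) <= d -> section_volume K u <= expR e * section_volume K w.
Proof.
move=> tK e e0; have [mK _ [b b0 Kb] PK] := tK.
pose t := e / m.+1%:R.
have t0 : 0 < t by rewrite divr_gt0.
have t1 : 0 < 1 + t by rewrite addr_gt0.
have tm : (1 + t) ^+ m <= expR e.
  apply: (@le_trans _ _ (expR t ^+ m)).
    by rewrite lerXn2r ?nnegrE ?expR_ge0 ?(ltW t1)// expR_ge1Dx.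
  rewrite -expRM_natl ler_expR /t mulrA ler_pdivrMr// mulrC.
  by rewrite ler_wpM2l ?ler_nat// ltW.
have [d' d'0 Kd] := PK _ t0.
(* The bound 1 forces |u + w| >= 1, since |u + w| + |u - w| >= 2; the other bound keeps the
   displacement 2 |x.(w - u)| / |u + w| of points |x| <= b below d'. *)
pose d := Num.min 1 (d' / (2 * b)).
have d0 : 0 < d by rewrite lt_min ltr01 divr_gt0// mulr_gt0.
exists d => // u w uS wS uw.
have uw1 : enorm (u - w) <= 1 by rewrite (le_trans uw)// /d ge_min lexx.
have uwd : enorm (u - w) <= d' / (2 * b).
  by rewrite (le_trans uw)// /d ge_min lexx orbT.
have nuw : 1 <= enorm (u + w).
  have := ler_enormD (u + w) (u - w).
  rewrite addrACA subrr addr0 -mulr2n -scaler_nat enormZ uS mulr1 normr_nat.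
  by move=> H; lra.
have uw0 : u + w != 0 by rewrite -enorm_gt0 (lt_le_trans _ nuw).
have [B uB] := exists_frame uS.
have wB := reflection_frame uS wS uw0 uB.
have Vw : 0 <= section_volume K w.
  by have [c c0 cK] := section_volume_gt0 tK; rewrite (le_trans (ltW c0))// cK.
apply: (@le_trans _ _ ((1 + t) ^+ m * section_volume K w)); last exact: ler_wpM2r.
have it1 : 0 < (1 + t)^-1 by rewrite invr_gt0.
rewrite -lee_fin (section_volumeE tK uS uB).
have -> : ((1 + t) ^+ m * section_volume K w)%:E = lebesgue_rV m
    [set y | K ((1 + t)^-1 *: (y *m (B *m reflection (u + w))))].
  by rewrite (section_volume_dilate tK wS wB it1) exprVn invrK.
apply: le_measure; rewrite ?inE.
- exact: measurable_section.
- rewrite (_ : [set _ | _] = (fun y : 'rV[R]_m => (1 + t)^-1 *: y + 0) @^-1`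
    [set y | K (y *m (B *m reflection (u + w)))]).
    apply: measurable_preimage; first exact: measurable_scale_shift.
    exact: measurable_section.
  by apply/seteqP; split=> y /=; rewrite addr0 scalemxAl.
move=> y /= Ky; apply: (Kd _ _ Ky).
rewrite mulmxA mulmx_reflection subKr enormZ.
(* Orthogonality to u allows the sign of u to be changed, and w - u is small. *)
have -> : dotr (y *m B) (u + w) = dotr (y *m B) (w - u).
  by rewrite !dotrDr dotrNr (frame_dotr _ uB) oppr0 addrC.
have dd : dotr (u + w) (u + w) = enorm (u + w) ^+ 2 by rewrite enorm_sqr.
have nuw0 := lt_le_trans ltr01 nuw.
have yb := Kb _ Ky; rewrite /eball/= in yb.
rewrite dd; set D := dotr _ _; set N := enorm _ in nuw nuw0 dd *.
have -> : `|2 * D / N ^+ 2| * N = 2 * `|D| / N.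
  rewrite normrM normfV (ger0_norm (sqr_ge0 N)) normrM normr_nat.
  by field; rewrite gt_eqF.
rewrite {}/D.
rewrite ler_pdivrMr//.
apply: (@le_trans _ _ d'); last by rewrite -[leLHS]mulr1 ler_wpM2l// ltW.
apply: (@le_trans _ _ (2 * (b * enorm (u - w)))).
  rewrite ler_wpM2l// (le_trans (CauchySchwarz _ _))// enormB ler_wpM2r ?enorm_ge0//.
by move: uwd; rewrite ler_pdivlMr ?mulr_gt0//; lra.
Qed.

(** The error splits into (x - y)/|y| and a change of length applied to x, whose norm cancels 1/|x|;
    only |y| remains in the denominator. *)
Lemma enorm_direction_sub x y : x != 0 -> y != 0 ->
  enorm (direction x - direction y) <= 2 * enorm (x - y) / enorm y.
Proof.
move=> x0 y0; have ex : 0 < enorm x by rewrite enorm_gt0.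
have ey : 0 < enorm y by rewrite enorm_gt0.
have -> : direction x - direction y =
    (enorm y)^-1 *: (x - y) + ((enorm x)^-1 - (enorm y)^-1) *: x.
  by rewrite /direction scalerBr scalerBl [RHS]addrC addrA subrK.
rewrite (le_trans (ler_enormD _ _))// !enormZ gtr0_norm ?invr_gt0//.
have -> : (enorm x)^-1 - (enorm y)^-1 = (enorm y - enorm x) / (enorm x * enorm y).
  by field; rewrite !gt_eqF.
rewrite normrM normfV (gtr0_norm (mulr_gt0 ex ey)).
have -> : `|enorm y - enorm x| / (enorm x * enorm y) * enorm x =
    `|enorm y - enorm x| / enorm y by field; rewrite !gt_eqF.
have : `|enorm y - enorm x| <= enorm (x - y).
  by rewrite ler_norml lerNl opprB ler_enormB/= enormB ler_enormB.
move=> /(ler_wpM2r (_ : 0 <= (enorm y)^-1)); rewrite invr_ge0 enorm_ge0 => /(_ isT).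
lra.
Qed.

(** Uniform continuity on the sphere with the error as a factor; exchanging u and w gives the
    reverse bound. *)
Definition mult_continuous (rho : 'rV[R]_m.+1 -> R) := forall e, 0 < e ->
  exists2 d, 0 < d & forall u w, unit_sphere m.+1 u -> unit_sphere m.+1 w ->
    enorm (u - w) <= d -> rho u <= expR e * rho w.

Lemma thick_star_set (rho : 'rV[R]_m.+1 -> R) (a b : R) : 0 < a -> (forall x, 0 <= rho x) ->
  measurable_fun setT rho -> mult_continuous rho ->
  (forall u, unit_sphere m.+1 u -> a <= rho u <= b) ->
  thick (star_set rho).
Proof.
move=> a0 rho0 mrho crho ab.
have b0 : 0 < b.
  have [u uS] : exists u, unit_sphere m.+1 u.
    exists (direction (const_mx 1 : 'rV[R]_m.+1)); apply: direction_sphere.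
    by apply/eqP => /rowP/(_ 0); rewrite !mxE => /eqP; rewrite oner_eq0.
  by have /andP[au ub] := ab _ uS; rewrite (lt_le_trans a0)// (le_trans au).
split.
- exact: measurable_star_set.
- exists a => // x; rewrite /eball/= star_setE// => /= xa.
  have [->|x0] := eqVneq x 0; first by rewrite enorm0 rho0.
  by rewrite (le_trans xa)//; case/andP: (ab _ (direction_sphere x0)).
- exists b => // x; rewrite star_setE//= => xr.
  have [->|x0] := eqVneq x 0; first by rewrite /eball/= enorm0 ltW.
  by rewrite /eball/= (le_trans xr)//; case/andP: (ab _ (direction_sphere x0)).
move=> e e0; have e1 : 0 < 1 + e by rewrite addr_gt0.
(* The factor 1 + e is split into two factors e^t: one for the step from |x| to |y|, one for the
   change of direction. *)
pose t := ln (1 + e) / 2.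
have t0 : 0 < t by rewrite divr_gt0// ln_gt0// ltrDl.
have tt : expR t * expR t = 1 + e.
  by rewrite -expRD -splitr lnK.
have [d1 d10 crd] := crho _ t0.
have et : 0 < expR t - 1 by rewrite subr_gt0 expR_gt1.
(* When |y| > a, the three bounds ensure respectively that x is not 0, that the directions of x and
   y are d1-close, and that |y| <= rho(direction x) + d <= e^t rho(direction x). *)
pose d := Num.min (a / 2) (Num.min (a * d1 / 2) ((expR t - 1) * a)).
have d0 : 0 < d by rewrite !lt_min !divr_gt0 ?mulr_gt0.
have da : d <= a / 2 by rewrite ge_min lexx.
have dd1 : d <= a * d1 / 2 by rewrite /d ge_min ge_min lexx orbT.
have det : d <= (expR t - 1) * a by rewrite /d !ge_min lexx !orbT.
exists d => // x y; rewrite star_setE//= => xr xy.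
rewrite directionZ ?invr_gt0// enormZ gtr0_norm ?invr_gt0// ler_pdivrMl//.
have [->|y0] := eqVneq y 0; first by rewrite enorm0 mulr_ge0// ltW.
have /andP[ay _] := ab _ (direction_sphere y0).
have [ya|ya] := leP (enorm y) a.
  apply: (le_trans ya); apply: (le_trans ay).
  by rewrite ler_peMl// lerDl ltW.
have yx : enorm y - enorm x <= enorm (x - y) by rewrite enormB ler_enormB.
have x0 : x != 0 by rewrite -enorm_gt0; lra.
have /andP[ax _] := ab _ (direction_sphere x0).
have /(crd _ _ (direction_sphere x0) (direction_sphere y0)) H :
    enorm (direction x - direction y) <= d1.
  rewrite (le_trans (enorm_direction_sub x0 y0))//.
  rewrite ler_pdivrMr ?enorm_gt0//.
  have : a * d1 <= enorm y * d1 by rewrite ler_wpM2r// ltW.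
  lra.
have : enorm y <= expR t * rho (direction x).
  have : (expR t - 1) * a <= (expR t - 1) * rho (direction x).
    by rewrite ler_wpM2l// ltW.
  rewrite mulrBl mul1r; lra.
move=> /le_trans; apply; rewrite -tt -mulrA ler_wpM2l// expR_ge0//.
Qed.

(** [direction] is discontinuous only at the origin; this point is split off, and on its complement
    the superlevel sets are open. *)
Lemma measurable_mult_continuous (rho : 'rV[R]_m.+1 -> R) :
  (forall u, unit_sphere m.+1 u -> 0 < rho u) -> mult_continuous rho ->
  measurable_fun setT (fun x => rho (direction x)).
Proof.
move=> rho0 crho.
have oD : open [set x : 'rV[R]_m.+1 | x != 0].
  rewrite openE => x /= x0; rewrite /interior; apply/nbhs_ballP.
  have ex : 0 < enorm x by rewrite enorm_gt0.
  exists (enorm x / (2 * m.+1%:R)) => [|y]; first by rewrite /= divr_gt0// mulr_gt0.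
  move=> /enorm_ball H /=; rewrite -enorm_gt0.
  have := ler_enormB x y; move: H.
  have M0 : m.+1%:R != 0 :> R by rewrite pnatr_eq0.
  have -> : m.+1%:R * (enorm x / (2 * m.+1%:R)) = enorm x / 2.
    by rewrite invfM mulrCA [_ * (2^-1 * _)]mulrCA divff// mulr1.
  lra.
have -> : [set: 'rV[R]_m.+1] = [set x | x != 0] `|` [set 0].
  apply/seteqP; split=> // x _; have [->|x0] := eqVneq x 0; first by right.
  by left.
have mD : measurable [set x : 'rV[R]_m.+1 | x != 0] by exact: sub_sigma_algebra.
have m0 : measurable [set 0 : 'rV[R]_m.+1].
  rewrite (_ : [set 0] = ~` [set x : 'rV[R]_m.+1 | x != 0]); first exact: measurableC.
  by apply/seteqP; split=> x /=; [move=> ->; rewrite eqxx|move/negP/negPn/eqP].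
apply/measurable_funU => //; split; last exact: measurable_fun_set1.
apply: (measurability _ (RGenOInfty.measurableE R)) => _ [_ [a ->] <-].
suff oA : open ([set x : 'rV[R]_m.+1 | x != 0] `&`
    (fun x => rho (direction x)) @^-1` `]a, +oo[%classic) by exact: sub_sigma_algebra.
rewrite openE => x [/= x0].
rewrite in_itv/= andbT => ax; rewrite /interior.
have [ax0|ax0] := ltP a 0.
  have : nbhs x [set x : 'rV[R]_m.+1 | x != 0] by exact: open_nbhs_nbhs.
  apply: filterS => y /= y0; split => //; rewrite in_itv/= andbT.
  by rewrite (lt_trans ax0)// rho0//; exact: direction_sphere.
have rx0 : 0 < rho (direction x) by rewrite rho0//; exact: direction_sphere.
(* Half the logarithm of rho(direction x)/a leaves room for nearby directions to keep a value above
   a. *)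
have [e e0 He] : exists2 e, 0 < e & expR e * a < rho (direction x).
  have [->|a0] := eqVneq a 0; first by exists 1; rewrite ?mulr0.
  have {}a0 : 0 < a by rewrite lt0r a0.
  exists (ln (rho (direction x) / a) / 2).
    by rewrite divr_gt0// ln_gt0// ltr_pdivlMr// mul1r.
  rewrite -ltr_pdivlMr// -[ltRHS]lnK ?posrE ?divr_gt0// ltr_expR.
  by rewrite ltr_pdivrMr// ltr_pMr ?ltr1n// ln_gt0// ltr_pdivlMr// mul1r.
have [d d0 Hd] := crho _ e0.
have ex : 0 < enorm x by rewrite enorm_gt0.
(* This gives |y| >= |x|/2 and then directions within 2 (|x| d/4)/(|x|/2) = d; dividing by m + 1
   passes to the maximum norm. *)
pose r := Num.min (enorm x / 2) (enorm x * d / 4) / m.+1%:R.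
have r0 : 0 < r by rewrite divr_gt0// lt_min !divr_gt0 ?mulr_gt0.
apply/nbhs_ballP; exists r => // y /enorm_ball.
have -> : m.+1%:R * r = Num.min (enorm x / 2) (enorm x * d / 4).
  by rewrite /r mulrC divfK// pnatr_eq0.
rewrite le_min => /andP[h1 h2].
have xy := ler_enormB x y.
have ey : enorm x / 2 <= enorm y by lra.
have y0 : y != 0 by rewrite -enorm_gt0 (lt_le_trans _ ey)// divr_gt0.
split => //=; rewrite in_itv/= andbT.
have : enorm (direction x - direction y) <= d.
  rewrite (le_trans (enorm_direction_sub x0 y0))// ler_pdivrMr ?enorm_gt0//.
  have : enorm x / 2 * d <= enorm y * d by rewrite ler_wpM2r// ltW.
  lra.
move=> /(Hd _ _ (direction_sphere x0) (direction_sphere y0)) H.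
by have := lt_le_trans He H; rewrite ltr_pM2l// expR_gt0.
Qed.


End bodies.

(** * Integrals with respect to comparable set functions *)

Section set_function_integral.
Context d (T : measurableType d) (R : realType).
Local Open Scope ereal_scope.
Import HBNNSimple.

(** The integral of a nonnegative function in unfolded form, for an arbitrary set function: the
    curvature set functions are not shown to be additive, so results about measures cannot be
    invoked for them. *)
Let nnint (mu : set T -> \bar R) (g : T -> \bar R) := ereal_sup [set sintegral mu h |
  h in [set h : {nnsfun T >-> R} | forall x, (h x)%:E <= g x]].

Lemma sintegral_range (mu : set T -> \bar R) (h : {nnsfun T >-> R}) : mu set0 = 0 ->
  sintegral mu h = \sum_(x \in range h) x%:E * mu (h @^-1` [set x]).
Proof.
move=> mu0; rewrite /sintegral (fsbig_widen (range h) setT)//= => x [_ Nhx] /=.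
by rewrite preimage10// mu0 mule0.
Qed.

Lemma sintegral_le_scale (mu nu : set T -> \bar R) (c : R) (h : {nnsfun T >-> R}) :
  mu set0 = 0 -> nu set0 = 0 -> (forall A, 0 <= nu A) ->
  (forall A, measurable A -> mu A <= c%:E * nu A) ->
  sintegral mu h <= c%:E * sintegral nu h.
Proof.
move=> mu0 nu0 nu_ge0 munu; rewrite sintegral_range// [in leRHS]/sintegral.
rewrite ge0_mule_fsumr; last first.
  move=> x; have [x0|x0] := leP 0%R x; first by rewrite mule_ge0// lee_fin.
  by rewrite preimage_nnfun0// nu0 mule0.
rewrite [leRHS](_ : _ = \sum_(x \in range h) c%:E * (x%:E * nu (h @^-1` [set x]))); last first.
  rewrite (fsbig_widen (range h) setT)//= => x [_ Nhx] /=.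
  by rewrite preimage10// nu0 !mule0.
apply: lee_fsum => // _ [t _ <-].
by rewrite muleCA lee_wpmul2l ?lee_fin// munu.
Qed.

Lemma nnint_le_scale (mu nu : set T -> \bar R) (c : R) (g : T -> \bar R) :
  (0 <= c)%R -> mu set0 = 0 -> nu set0 = 0 -> (forall A, 0 <= nu A) ->
  (forall A, measurable A -> mu A <= c%:E * nu A) ->
  nnint mu g <= c%:E * nnint nu g.
Proof.
move=> c0 mu0 nu0 nu_ge0 munu; apply: ge_ereal_sup => _ [h /= hg <-].
apply: (le_trans (sintegral_le_scale h mu0 nu0 nu_ge0 munu)).
by apply: lee_wpmul2l; [rewrite lee_fin|apply: ereal_sup_ubound; exists h].
Qed.

Lemma nnint_ge0 (mu : set T -> \bar R) (g : T -> \bar R) : mu set0 = 0 ->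
  (forall x, 0 <= g x) -> 0 <= nnint mu g.
Proof.
move=> mu0 g0; apply: ereal_sup_ubound; exists nnsfun0 => //.
rewrite sintegral_range// fsbig1// => x [t _ <-].
by rewrite mul0e.
Qed.

(** The second conclusion is stronger than convergence to +oo: the values equal +oo eventually. This
    is what settles differences of two infinite integrals. *)
Lemma cvg_mult_ereal (X : Type) (F : set_system X) (a : X -> \bar R) (b : \bar R) :
  Filter F -> 0 <= b ->
  (forall e, (0 < e)%R -> \forall p \near F, a p <= (expR e)%:E * b /\ b <= (expR e)%:E * a p) ->
  a p @[p --> F] --> b /\ (b = +oo -> \forall p \near F, a p = +oo).
Proof.
move=> FF b0 ab; have inf : b = +oo -> \forall p \near F, a p = +oo.
  move=> by_; have := ab 1%R ltr01; apply: filterS => p [_].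
  by case: (a p) => [r| |]; rewrite by_// mulrNy gtr0_sg ?expR_gt0// mul1e.
split => //; move: b0 ab inf; case: b => [r| |]//; last first.
  move=> _ _ /(_ erefl) H; apply: cvg_near_cst.
  by apply: filterS H => p ->.
rewrite lee_fin => r0 ab _; apply/fine_cvgP.
have key e : (0 < e)%R -> \forall p \near F, exists2 s, a p = s%:E &
    (s <= expR e * r /\ r <= expR e * s)%R.
  move=> e0; have := ab e e0; apply: filterS => p.
  case: (a p) => [s| |]; rewrite -?EFinM ?lee_fin; first by exists s.
    by move=> [].
  by rewrite mulrNy gtr0_sg ?expR_gt0// mul1e => -[].
split; first by apply: filterS (key _ ltr01) => p [s ->].
apply/cvgrPdist_le => e e0.
(* The multiplicative error 1 + e/(r + 1) changes r by at most e; adding 1 covers r = 0. *)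
have r1 : (0 < r + 1)%R by rewrite ltr_wpDl.
have er : (0 < e / (r + 1))%R by rewrite divr_gt0.
have lne : (0 < ln (1 + e / (r + 1)))%R by rewrite ln_gt0// ltrDl.
have := key _ lne; apply: filterS => p [s /= -> /=].
rewrite lnK ?posrE ?addr_gt0//.
set q := (1 + e / (r + 1))%R => -[h1 h2].
have q1 : (1 <= q)%R by rewrite /q lerDl ltW.
have qr : ((q - 1) * r <= e)%R.
  rewrite /q addrC addKr mulrAC ler_pdivrMr//.
  by rewrite ler_wpM2l ?(ltW e0)// lerDl.
rewrite ler_norml; apply/andP; split; first by move: h1; lra.
have [rs|rs] := leP r s; first by lra.
have : ((q - 1) * s <= (q - 1) * r)%R by rewrite ler_wpM2l ?subr_ge0// ltW.
lra.
Qed.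

(* The integral is a supremum of sums that are linear in the set function, so
   that multiplicative bounds pass to it even without additivity. *)
Lemma cvg_integral_set_function (X : Type) (F : set_system X) (D : set T)
    (mu : X -> set T -> \bar R) (nu : set T -> \bar R) (f : T -> \bar R) : Filter F ->
  (forall p, mu p set0 = 0) -> nu set0 = 0 ->
  (\forall p \near F, forall A, 0 <= mu p A) -> (forall A, 0 <= nu A) ->
  (forall e, (0 < e)%R -> \forall p \near F, forall A, measurable A ->
    mu p A <= (expR e)%:E * nu A /\ nu A <= (expR e)%:E * mu p A) ->
  \int[mu p]_(x in D) f x @[p --> F] --> \int[nu]_(x in D) f x.
Proof.
move=> FF mu0 nu0 mu_ge0 nu_ge0 munu.
have key g : (forall x, 0 <= g x) ->
    nnint (mu p) g @[p --> F] --> nnint nu g /\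
    (nnint nu g = +oo -> \forall p \near F, nnint (mu p) g = +oo).
  move=> g0; apply: cvg_mult_ereal; first exact: nnint_ge0.
  move=> e e0; apply: filterS2 mu_ge0 (munu e e0) => p mup_ge0 H.
  by split; apply: (nnint_le_scale g (expR_ge0 e)) => // A /H[].
pose fp := (f \_ D)^\+; pose fn := (f \_ D)^\-.
have [cp ip] : nnint (mu p) fp @[p --> F] --> nnint nu fp /\
    (nnint nu fp = +oo -> \forall p \near F, nnint (mu p) fp = +oo)
  by apply: key => x; exact: funepos_ge0.
have [cn i_n] : nnint (mu p) fn @[p --> F] --> nnint nu fn /\
    (nnint nu fn = +oo -> \forall p \near F, nnint (mu p) fn = +oo)
  by apply: key => x; exact: funeneg_ge0.
have a0 : 0 <= nnint nu fp by apply: nnint_ge0 => // x; exact: funepos_ge0.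
have b0 : 0 <= nnint nu fn by apply: nnint_ge0 => // x; exact: funeneg_ge0.
(* The library integral unfolds to this difference for any set function. *)
change (nnint (mu p) fp - nnint (mu p) fn @[p --> F] --> nnint nu fp - nnint nu fn).
have [py|pfin] := eqVneq (nnint nu fp) +oo; last first.
  apply: cvgeB => //; apply: fin_num_adde_defr.
  by rewrite ge0_fin_numE// ltey.
have [ny|nfin] := eqVneq (nnint nu fn) +oo; last first.
  apply: cvgeB => //; apply: fin_num_adde_defl.
  by rewrite fin_numN ge0_fin_numE// ltey.
(* Both parts are eventually +oo, so the difference is eventually the same conventional value as in
   the limit. *)
apply: cvg_near_cst; move: (ip py) (i_n ny); apply: filterS2 => p -> ->.
by rewrite py ny.
Qed.

End set_function_integral.

Section nonmeasurable_integral.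
Context d (T : measurableType d) (R : realType).
Variable mu : {measure set T -> \bar R}.
Local Open Scope ereal_scope.
Import HBNNSimple.

(** A simple function h below f yields h/c below g, so the suprema compare without measurability of
    f, g or D. This is what allows arbitrary sets [reverse_radial_gauss K eta] as domains. *)
Lemma ge0_integral_le_scale (D : set T) (f g : T -> \bar R) (c : R) : (0 < c)%R ->
  (forall x, D x -> 0 <= f x) -> (forall x, D x -> f x <= c%:E * g x) ->
  \int[mu]_(x in D) f x <= c%:E * \int[mu]_(x in D) g x.
Proof.
move=> c0 f0 fg.
have g0 x : D x -> 0 <= g x.
  by move=> Dx; have := le_trans (f0 _ Dx) (fg _ Dx); rewrite pmule_rge0.
rewrite !ge0_integralE//; apply: ge_ereal_sup => _ [h /= hf <-].
have ic0 : (0 <= c^-1)%R by rewrite invr_ge0 ltW.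
pose h' := scale_nnsfun h ic0.
have -> : sintegral mu h = c%:E * sintegral mu h'.
  by rewrite sintegralrM muleA -EFinM mulfV ?mul1e// gt_eqF.
apply: lee_wpmul2l; first by rewrite lee_fin ltW.
apply: ereal_sup_ubound; exists h' => //= x.
have := hf x; rewrite !patchE; case: ifPn => [/set_mem Dx|_] hx.
  by rewrite EFinM lee_pdivrMl//; exact: le_trans (fg _ Dx).
by rewrite EFinM mule_ge0_le0// lee_fin.
Qed.

Lemma ge0_scale_integral_le (D : set T) (f g : T -> \bar R) (c k l : R) :
  (0 < c)%R -> (0 < k)%R -> (0 < l)%R ->
  (forall x, D x -> 0 <= f x) -> (forall x, D x -> k%:E * f x <= c%:E * (l%:E * g x)) ->
  k%:E * \int[mu]_(x in D) f x <= c%:E * (l%:E * \int[mu]_(x in D) g x).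
Proof.
move=> c0 k0 l0 f0 fg.
have -> : c%:E * (l%:E * \int[mu]_(x in D) g x) =
    k%:E * ((k^-1 * c * l)%:E * \int[mu]_(x in D) g x).
  by rewrite !muleA -!EFinM !mulrA mulfV ?mul1r// gt_eqF.
apply: lee_wpmul2l; first by rewrite lee_fin ltW.
apply: ge0_integral_le_scale => //; first by rewrite !mulr_gt0 ?invr_gt0.
move=> x Dx; rewrite -mulrA EFinM -muleA lee_pdivlMl//.
by rewrite EFinM -muleA; exact: fg.
Qed.

End nonmeasurable_integral.

(** * Asymptotic equality of the densities *)

Lemma near_left1_and {R : realType} (P Q : R -> Prop) :
  (\forall p \near 1^'-, P p) -> (\forall p \near 1^'-, Q p) ->
  \forall p \near 1^'-, P p /\ Q p.
Proof. by move=> nP nQ; apply: filterS2 nP nQ => p. Qed.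

Section mequiv_algebra.
Context {R : realType} {n : nat}.
Implicit Types (F G H : R -> 'rV[R]_n -> R) (c : R -> R).

Definition eventually_ge0 F :=
  \forall p \near 1^'-, forall u, unit_sphere n u -> 0 <= F p u.

Lemma mequiv_trans F G H : mequiv F G -> mequiv G H -> mequiv F H.
Proof.
move=> FG GH e e0; have e2 : 0 < e / 2 by rewrite divr_gt0.
have := FG _ e2; have := GH _ e2; apply: filterS2 => p h1 h2 u uS.
have [h1l h1r] := h1 u uS; have [h2l h2r] := h2 u uS.
rewrite (splitr e) expRD; split.
  by rewrite (le_trans h2l)// -mulrA ler_wpM2l// expR_ge0.
by rewrite (le_trans h1r)// -mulrA ler_wpM2l// expR_ge0.
Qed.

Lemma eq_mequiv F F' G G' :
  (\forall p \near 1^'-, forall u, unit_sphere n u -> F p u = F' p u) ->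
  (\forall p \near 1^'-, forall u, unit_sphere n u -> G p u = G' p u) ->
  mequiv F' G' -> mequiv F G.
Proof.
move=> FF GG FG e e0; apply: filterS3 FF GG (FG _ e0) => p FF GG H u uS.
by rewrite FF// GG//; exact: H.
Qed.

Lemma mequivM F G F' G' : eventually_ge0 F -> eventually_ge0 G ->
  eventually_ge0 F' -> eventually_ge0 G' -> mequiv F G -> mequiv F' G' ->
  mequiv (fun p u => F p u * F' p u) (fun p u => G p u * G' p u).
Proof.
move=> F0 G0 F'0 G'0 FG FG' e e0; have e2 : 0 < e / 2 by rewrite divr_gt0.
have FF' := near_left1_and F0 F'0.
have GG' := near_left1_and G0 G'0.
have HH := near_left1_and (FG _ e2) (FG' _ e2).
apply: filterS3 FF' GG' HH => p [Fp F'p] [Gp G'p] [h h'] u uS.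
have [h1 h2] := h u uS; have [h'1 h'2] := h' u uS.
rewrite (splitr e) expRD; split; rewrite mulrACA ler_pM//.
- exact: Fp.
- exact: F'p.
- exact: Gp.
- exact: G'p.
Qed.

(** A power at most C multiplies the logarithmic error by at most C, so the bases are compared up to
    e/(C + 1). *)
Lemma mequiv_powR F G c C : 0 <= C -> eventually_ge0 F -> eventually_ge0 G ->
  (\forall p \near 1^'-, 0 <= c p <= C) -> mequiv F G ->
  mequiv (fun p u => F p u `^ c p) (fun p u => G p u `^ c p).
Proof.
move=> C_ge0 F0 G0 cC FG e e0.
have C0 : 0 < C + 1 by rewrite ltr_wpDl.
have eC : 0 < e / (C + 1) by rewrite divr_gt0.
have FG0 := near_left1_and F0 G0.
apply: filterS3 FG0 cC (FG _ eC) => p [Fp Gp] /andP[cp0 cpC] h u uS.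
have [h1 h2] := h u uS; have {}Fp := Fp u uS; have {}Gp := Gp u uS.
have eE : expR (e / (C + 1)) `^ c p <= expR e.
  rewrite /powR gt_eqF ?expR_gt0// expRK ler_expR mulrCA ger_pMr//.
  by rewrite ler_pdivrMr// mul1r (le_trans cpC)// lerDl.
split.
  apply: (@le_trans _ _ ((expR (e / (C + 1)) * G p u) `^ c p)).
    by apply: ge0_ler_powR; rewrite ?nnegrE ?mulr_ge0 ?expR_ge0.
  by rewrite powRM ?expR_ge0// ler_wpM2r ?powR_ge0.
apply: (@le_trans _ _ ((expR (e / (C + 1)) * F p u) `^ c p)).
  by apply: ge0_ler_powR; rewrite ?nnegrE ?mulr_ge0 ?expR_ge0.
by rewrite powRM ?expR_ge0// ler_wpM2r ?powR_ge0.
Qed.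

(** On [a, b] the logarithm is bounded by |ln a| + |ln b|, so changing the exponent by O(1 - p)
    costs a factor e^(O(1 - p)), uniformly on the sphere. *)
Lemma mequiv_exponent (h : 'rV[R]_n -> R) (a b C : R) c c' : 0 < a -> 0 <= C ->
  (forall u, unit_sphere n u -> a <= h u <= b) ->
  (\forall p \near 1^'-, `|c p - c' p| <= C * (1 - p)) ->
  mequiv (fun p u => h u `^ c p) (fun p u => h u `^ c' p).
Proof.
move=> a0 C0 hab cc e e0.
pose M := `|ln a| + `|ln b|.
have CM : 0 <= C * M by rewrite mulr_ge0// addr_ge0.
have eta0 : 0 < e / (C * M + 1) by rewrite divr_gt0// ltr_wpDl.
have key (s s' q : R) u : unit_sphere n u -> 0 <= q -> q < e / (C * M + 1) ->
    `|s - s'| <= C * q -> h u `^ s <= expR e * h u `^ s'.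
  move=> uS q0 qe ss; have /andP[au ub] := hab u uS.
  have h0 : 0 < h u by exact: lt_le_trans au.
  rewrite /powR gt_eqF// -expRD ler_expR -lerBlDr -mulrBl.
  have lnM : `|ln (h u)| <= M.
    have lna : ln a <= ln (h u) by rewrite ler_ln.
    have lnb : ln (h u) <= ln b by rewrite ler_ln// posrE (lt_le_trans h0).
    rewrite ler_norml /M; apply/andP; split.
      have := ler_norm (- ln a); rewrite normrN => H1.
      by have := normr_ge0 (ln b); lra.
    have := ler_norm (ln b) => H1.
    by have := normr_ge0 (ln a); lra.
  apply: (le_trans (ler_norm _)); rewrite normrM.
  apply: (@le_trans _ _ (C * q * M)); first by rewrite ler_pM.
  move: qe; rewrite ltr_pdivlMr ?ltr_wpDl// => qe.
  by rewrite mulrAC mulrC; lra.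
near=> p => u uS.
have pe : 1 - p < e / (C * M + 1).
  by rewrite ltrBlDl -ltrBlDr; near: p; apply: nbhs_left_gt; rewrite ltrBlDr ltrDl.
have p1 : 0 <= 1 - p by rewrite subr_ge0 ltW//; near: p; exact: nbhs_left_lt.
have ccp : `|c p - c' p| <= C * (1 - p) by near: p.
by split; apply: (key _ _ (1 - p)) => //; rewrite distrC.
Unshelve. all: by end_near. Qed.

(** Finiteness matters because the real-valued integral sends +oo to 0: the inequalities hold
    between extended integrals and descend only when both are finite. *)
Lemma mequiv_cosine_transform F G : eventually_ge0 F -> eventually_ge0 G ->
  (\forall p \near 1^'-, forall v, unit_sphere n v ->
    (\int[spherical_measure n]_(u in unit_sphere n)
       (G p u * `|dotr v u| `^ (- p))%:E)%E \is a fin_num) ->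
  mequiv F G ->
  mequiv (fun p => cosine_transform (- p) (F p)) (fun p => cosine_transform (- p) (G p)).
Proof.
move=> F0 G0 Gfin FG e e0.
have FG0 := near_left1_and F0 G0.
apply: filterS3 FG0 Gfin (FG _ e0) => p [Fp Gp] finG h v vS.
have {}finG := finG v vS.
have FleG : (\int[spherical_measure n]_(u in unit_sphere n)
     (F p u * `|dotr v u| `^ (- p))%:E <=
   (expR e)%:E * \int[spherical_measure n]_(u in unit_sphere n)
     (G p u * `|dotr v u| `^ (- p))%:E)%E.
  apply: ge0_integral_le_scale; first exact: expR_gt0.
    by move=> u uS; rewrite lee_fin mulr_ge0 ?powR_ge0// Fp.
  move=> u uS; rewrite -EFinM lee_fin mulrA ler_wpM2r ?powR_ge0//.
  by have [] := h u uS.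
have GleF : (\int[spherical_measure n]_(u in unit_sphere n)
     (G p u * `|dotr v u| `^ (- p))%:E <=
   (expR e)%:E * \int[spherical_measure n]_(u in unit_sphere n)
     (F p u * `|dotr v u| `^ (- p))%:E)%E.
  apply: ge0_integral_le_scale; first exact: expR_gt0.
    by move=> u uS; rewrite lee_fin mulr_ge0 ?powR_ge0// Gp.
  move=> u uS; rewrite -EFinM lee_fin mulrA ler_wpM2r ?powR_ge0//.
  by have [] := h u uS.
rewrite /cosine_transform /Rintegral.
set IF := (\int[_]_(_ in _) (F _ _ * _)%:E)%E in FleG GleF *.
set IG := (\int[_]_(_ in _) (G _ _ * _)%:E)%E in finG FleG GleF *.
have IF0 : (0 <= IF)%E.
  by apply: integral_ge0 => u uS; rewrite lee_fin mulr_ge0 ?powR_ge0// Fp.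
have finF : IF \is a fin_num.
  rewrite ge0_fin_numE// (le_lt_trans FleG)//.
  by move: finG; case: IG {FleG GleF} => //= r _; rewrite -EFinM ltry.
move: FleG GleF; rewrite -(fineK finF) -(fineK finG) -!EFinM !lee_fin.
by [].
Qed.

End mequiv_algebra.

(** * Limit of the density of the p-affine dual curvature measure *)

Section densities.
Context {R : realType} {m : nat}.
Variable K : set 'rV[R]_m.+1.
Hypothesis m0 : (0 < m)%N.
Hypothesis tK : thick K.
Local Notation n := m.+1.
Local Notation N := (n%:R : R).

(** The radial function of I K on the sphere, extended to be constant along rays: [section_volume]
    is meaningful only at unit vectors, while measurability is needed on the whole space. *)
Let rho (x : 'rV[R]_n) := section_volume K (direction x).
Let L := star_set rho.

Let rho_sphere u : unit_sphere n u -> rho u = section_volume K u.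
Proof. by move=> uS; rewrite /rho direction_unit. Qed.

Let rho_ge0 x : 0 <= rho x.
Proof. by rewrite /rho /section_volume /hyperplane_volume fine_ge0. Qed.

Let rho_bounds : exists ab : R * R, 0 < ab.1 /\
  forall u, unit_sphere n u -> ab.1 <= rho u <= ab.2.
Proof.
have [a a0 aK] := section_volume_gt0 tK; have [b b0 Kb] := section_volume_bounded tK.
by exists (a, b); split => // u uS; rewrite rho_sphere// aK//= Kb.
Qed.

Let section_gt0 (M : set 'rV[R]_n) u : thick M -> unit_sphere n u -> 0 < section_volume M u.
Proof. by move=> /section_volume_gt0 [a a0 aK] uS; exact: lt_le_trans (aK _ uS). Qed.

Let measurable_rho : measurable_fun setT rho.
Proof.
apply: measurable_mult_continuous; first by move=> u uS; exact: section_gt0.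
exact: section_volume_continuous.
Qed.

Let thick_L : thick L.
Proof.
have [[a b] /= [a0 ab]] := rho_bounds.
apply: (thick_star_set a0 rho_ge0 measurable_rho _ ab).
move=> e e0; have [d d0 H] := section_volume_continuous tK e0.
by exists d => // u w uS wS uw; rewrite !rho_sphere//; exact: H.
Qed.

Lemma eq_star_set (r r' : 'rV[R]_n -> R) :
  (forall u, unit_sphere n u -> r u = r' u) -> star_set r = star_set r'.
Proof.
move=> rr; apply/seteqP; split=> x [u [t [uS ht ->]]]; exists u, t; split => //.
  by rewrite -rr.
by rewrite rr.
Qed.

Let intersection_bodyE : intersection_body K = L.
Proof. by apply: eq_star_set => u uS; rewrite rho_sphere. Qed.

Let radial_intersection_body2 u : unit_sphere n u ->
  radial_function (intersection_body (intersection_body K)) u = section_volume L u.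
Proof.
move=> uS; rewrite intersection_bodyE star_radial_function//.
by rewrite ltW//; exact: (section_gt0 thick_L).
Qed.

Let near01 : \forall p \near (1 : R)^'-, 0 < p < 1.
Proof. by apply: (@near_left1 _ _ 1). Qed.

Let near_half : \forall p \near (1 : R)^'-, 2^-1 <= p < 1.
Proof.
apply: (@near_left1 _ _ 2^-1); rewrite ?invr_gt0// => p /andP[_ p1] h.
by apply/andP; split => //; lra.
Qed.

Let N1 : 1 <= N. Proof. by rewrite ler1n. Qed.

Lemma cosine_volume_ge0 (M : set 'rV[R]_n) p v : p < 1 -> 0 <= cosine_volume M p v.
Proof.
move=> p1; rewrite mulr_ge0// ?divr_ge0 ?subr_ge0 ?(ltW p1)//.
by apply: Rintegral_ge0 => x _; exact: powR_ge0.
Qed.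

Let cosine_volume_ge0_near (M : set 'rV[R]_n) : eventually_ge0 (cosine_volume M).
Proof. by apply: filterS near01 => p /andP[_ p1] u _; exact: cosine_volume_ge0. Qed.

(** The radial function of I_p K carries a power 1/p, so the exponent is c p = (N - p)/p. The base
    is replaced first, then the exponent, using c p - (N - p) = (N - p)(1 - p)/p; the constant 2N
    comes from p >= 1/2. *)
Let mequiv_radial_Lp : mequiv
  (fun p u => radial_function (Lp_intersection_body p K) u `^ (N - p))
  (fun p u => rho u `^ (N - p)).
Proof.
pose c p := p^-1 * (N - p).
apply: (@eq_mequiv _ _ _ (fun p u => cosine_volume K p u `^ c p) _
  (fun p u => rho u `^ (N - p))).
- apply: filterS near01 => p _ u uS.
  rewrite star_radial_function ?powR_ge0//.
  by rewrite -powRrM.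
- by apply: filterS near01.
have c_bound : \forall p \near (1 : R)^'-, 0 <= c p <= 2 * N.
  apply: filterS near_half => p /andP[p2 p1].
  have p0 : 0 < p by apply: lt_le_trans p2; rewrite invr_gt0.
  have Np : 0 <= N - p by have := N1; lra.
  rewrite /c mulr_ge0 ?invr_ge0 ?(ltW p0)//= ler_pdivrMl//.
  have : N <= p * 2 * N by rewrite ler_peMl// -ler_pdivrMr// mul1r.
  by rewrite mulrA; lra.
have rho_near : eventually_ge0 (fun _ : R => rho) by apply: filterS near01.
apply: (@mequiv_trans _ _ _ (fun p u => rho u `^ c p)).
  apply: (mequiv_powR _ (cosine_volume_ge0_near K) rho_near c_bound).
    by rewrite mulr_ge0.
  apply: (eq_mequiv _ _ (mequiv_cosine_volume tK)); first by apply: filterS near01.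
  by apply: filterS near01 => p _ u uS; rewrite rho_sphere.
have [[a b] /= [a0 ab]] := rho_bounds.
apply: (mequiv_exponent a0 _ ab (C := 2 * N)); first by rewrite mulr_ge0.
apply: filterS near_half => p /andP[p2 p1].
have p0 : 0 < p by apply: lt_le_trans p2; rewrite invr_gt0.
have Np : 0 <= N - p by have := N1; lra.
rewrite (_ : c p - (N - p) = p^-1 * ((N - p) * (1 - p))); last first.
  by rewrite /c; field; rewrite gt_eqF.
have q0 : 0 <= 1 - p by lra.
rewrite ger0_norm; last by rewrite !mulr_ge0 ?invr_ge0 ?(ltW p0).
rewrite mulrA ler_wpM2r// ler_pdivrMl//.
have : N <= p * 2 * N by rewrite ler_peMl// -ler_pdivrMr// mul1r.
by rewrite mulrA; lra.
Qed.

Let sphere_integral p v : 0 < p < 1 -> unit_sphere n v ->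
  (\int[spherical_measure n]_(u in unit_sphere n)
      (rho u `^ (N - p) * `|dotr v u| `^ (- p))%:E =
   ((N - p) * (2 / (1 - p) * cosine_volume L p v))%:E)%E.
Proof.
move=> p01 vS; rewrite (integral_sphere_star _ v p01 rho_ge0 measurable_rho)//.
by rewrite (cosine_volumeE thick_L p01 vS) -EFinM.
Qed.

Lemma mequiv_refl (F : R -> 'rV[R]_n -> R) : eventually_ge0 F -> mequiv F F.
Proof.
move=> F0 e e0; apply: filterS F0 => p F0 u uS.
have H : F p u <= expR e * F p u.
  by rewrite ler_peMl ?F0// ltW// expR_gt1.
by [].
Qed.

Let mequiv_cosine : mequiv
  (fun p => cosine_transform (- p)
     (fun u => radial_function (Lp_intersection_body p K) u `^ (N - p)))
  (fun p v => (N - p) * (2 / (1 - p) * cosine_volume L p v)).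
Proof.
apply: (eq_mequiv _ _ (mequiv_cosine_transform _ _ _ mequiv_radial_Lp)).
- by apply: filterS near01.
- apply: filterS near01 => p p01 v vS.
  by rewrite /cosine_transform /Rintegral sphere_integral.
- by apply: filterS near01 => p _ u _; exact: powR_ge0.
- by apply: filterS near01 => p _ u _; exact: powR_ge0.
- by apply: filterS near01 => p p01 v vS; rewrite sphere_integral.
Qed.

Lemma mequiv_radial_powR : mequiv (fun p u => radial_function K u `^ (N - p))
  (fun _ u => radial_function K u ^+ m).
Proof.
have [[a b] /= [a0 ab]] := radial_function_bounds tK.
apply: (@eq_mequiv _ _ _ (fun p u => radial_function K u `^ (N - p)) _
  (fun p u => radial_function K u `^ (N - 1))).
- by apply: filterS near01.
- apply: filterS near01 => p _ u uS.
  have /andP[au _] := ab u uS.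
  by rewrite -(natrB _ (ltn0Sn m)) subn1/= powR_mulrn// (le_trans (ltW a0)).
apply: (mequiv_exponent a0 ler01 ab).
apply: filterS near01 => p /andP[_ p1].
rewrite mul1r opprB addrC subrKA.
by rewrite ger0_norm// subr_ge0 ltW.
Qed.

(** This quotient is what remains of the prefactor (1 - p)/(2p) after the factors N - p and 2/(1 -
    p) of the cosine transform are absorbed. *)
Lemma mequiv_constant : mequiv (fun p (_ : 'rV[R]_n) => (N - p) / p) (fun _ _ => N - 1).
Proof.
(* Since N - 1 >= 1, the excess (N - p) - p (N - 1) is at most 2 (1 - p)(N - 1) <= e/2 (N - 1),
   which is at most e p (N - 1) as p >= 1/2. *)
move=> e e0; apply: (@near_left1 _ _ (Num.min 2^-1 (e / 4))).
  by rewrite lt_min invr_gt0 ltr0n divr_gt0.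
move=> p /andP[p0 p1]; rewrite lt_min => /andP[p2 pe] u _.
have ee : 1 + e <= expR e by exact: expR_ge1Dx.
have N2 : 1 <= N - 1 by rewrite -(natrB _ (ltn0Sn m)) subn1/= ler1n.
split.
  apply: (@le_trans _ _ ((1 + e) * (N - 1))); last by rewrite ler_wpM2r// (le_trans ler01).
  rewrite ler_pdivrMr//.
  have : e * (N - 1) * 2^-1 <= e * (N - 1) * p.
    by rewrite ler_wpM2l ?mulr_ge0 ?(ltW e0) ?(le_trans ler01)//; lra.
  have : (1 - p) * (N - 1) <= e / 4 * (N - 1).
    by rewrite ler_wpM2r ?(le_trans ler01)// ltW.
  have : (1 - p) * 1 <= (1 - p) * (N - 1) by rewrite ler_wpM2l// subr_ge0 ltW.
  lra.
apply: (@le_trans _ _ ((N - p) / p)).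
  rewrite ler_pdivlMr//.
  have : (N - 1) * p <= (N - 1) * 1 by rewrite ler_wpM2l ?(ltW p1)// (le_trans ler01).
  lra.
rewrite ler_peMl//; last by rewrite ltW// expR_gt1.
by rewrite divr_ge0 ?(ltW p0)// subr_ge0 (le_trans (ltW p1)).
Qed.

Lemma mequiv_density : mequiv
  (fun p u => (1 - p) / (2 * `|p|) * (radial_function K u `^ (N - p) *
     cosine_transform (- p)
       (fun u => radial_function (Lp_intersection_body p K) u `^ (N - p)) u))
  (fun _ u => m%:R * (radial_function K u ^+ m *
     radial_function (intersection_body (intersection_body K)) u)).
Proof.
have L0 := cosine_volume_ge0_near L.
have P0 : eventually_ge0 (fun p u => (1 - p) / (2 * `|p|) * radial_function K u `^ (N - p)).
  apply: filterS near01 => p /andP[p0 p1] u uS.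
  by rewrite mulr_ge0 ?powR_ge0// divr_ge0 ?subr_ge0 ?(ltW p1)// mulr_ge0.
have T0 : eventually_ge0 (fun p => cosine_transform (- p)
     (fun u => radial_function (Lp_intersection_body p K) u `^ (N - p))).
  apply: filterS near01 => p _ u uS; apply: Rintegral_ge0 => x _.
  by rewrite mulr_ge0 ?powR_ge0.
have U0 : eventually_ge0 (fun p v => (N - p) * (2 / (1 - p) * cosine_volume L p v)).
  apply: filterS near01 => p /andP[p0 p1] u uS.
  apply: mulr_ge0; first by rewrite subr_ge0 (le_trans (ltW p1)).
  apply: mulr_ge0; last exact: cosine_volume_ge0.
  by rewrite divr_ge0 ?subr_ge0 ?(ltW p1).
have C0 : eventually_ge0 (fun p (_ : 'rV[R]_n) => (N - p) / p).
  apply: filterS near01 => p /andP[p0 p1] u uS.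
  by rewrite divr_ge0 ?(ltW p0)// subr_ge0 (le_trans (ltW p1)).
have C1 : eventually_ge0 (fun (_ : R) (_ : 'rV[R]_n) => N - 1).
  by apply: filterS near01 => p _ u _; rewrite subr_ge0.
have K0 : eventually_ge0 (fun p u => radial_function K u `^ (N - p)).
  by apply: filterS near01 => p _ u uS; rewrite powR_ge0.
have [[a b] /= [a0 ab]] := radial_function_bounds tK.
have K1 : eventually_ge0 (fun _ u => radial_function K u ^+ m).
  apply: filterS near01 => p _ u uS; rewrite exprn_ge0//.
  by have /andP[au _] := ab u uS; rewrite (le_trans (ltW a0)).
have V0 : eventually_ge0 (fun _ => section_volume L).
  by apply: filterS near01 => p _ u uS; rewrite ltW//; exact: section_gt0.
have M1 := mequivM P0 P0 T0 U0 (mequiv_refl P0) mequiv_cosine.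
have M2 := mequivM K0 K1 L0 V0 mequiv_radial_powR (mequiv_cosine_volume thick_L).
have M2l : eventually_ge0 (fun p u => radial_function K u `^ (N - p) * cosine_volume L p u).
  by apply: filterS (near_left1_and K0 L0) => p [h h'] u uS; rewrite mulr_ge0 ?h ?h'.
have M2r : eventually_ge0 (fun _ u => radial_function K u ^+ m * section_volume L u).
  by apply: filterS (near_left1_and K1 V0) => p [h h'] u uS; rewrite mulr_ge0 ?h ?h'.
have M3 := mequivM C0 C1 M2l M2r mequiv_constant M2.
(* In this intermediate density the vanishing factor 1 - p has cancelled against the divergence of
   the cosine transform. *)
apply: (mequiv_trans (G := fun p u =>
  (N - p) / p * (radial_function K u `^ (N - p) * cosine_volume L p u))).
  apply: (eq_mequiv _ _ M1).
    by apply: filterS near01 => p _ u _; rewrite mulrA.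
  apply: filterS near01 => p /andP[p0 p1] u uS; rewrite gtr0_norm//.
  by field; rewrite !gt_eqF ?subr_gt0.
apply: (eq_mequiv _ _ M3); first by apply: filterS near01.
apply: filterS near01 => p _ u uS; rewrite radial_intersection_body2//.
by rewrite -(natrB _ (ltn0Sn m)) subn1.
Qed.

End densities.

(** * Weak convergence of the curvature measures *)

Lemma radial_function_ge0 (R : realType) n (K : set 'rV[R]_n) u : 0 <= radial_function K u.
Proof.
rewrite /radial_function; set E := [set _ | _].
have [Esup|/sup_out ->//] := pselect (has_sup E).
have [[t Et] _] := Esup; apply: (@le_trans _ _ t); first by case: Et.
by apply: ub_le_sup => //; case: Esup.
Qed.

Theorem proposition2 (R : realType) (n : nat) (K : set 'rV[R]_n) :
  (2 <= n)%N -> convex_body_o K ->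
  weak_cvg_sphere (fun p : R => p_affine_dual_curvature p K) (1 : R)^'-
    (fun eta => ((n%:R * unit_ball_volume n)%:E * affine_dual_curvature K eta)%E).
Proof.
case: n K => [//|m] K m0 cK.
have tK := convex_body_thick cK.
(* The unit ball has positive finite volume, so n omega_n cancels in [nuE] and the limit has density
   factor n - 1. *)
have [w [w0 wE]] := @lebesgue_ball_bounds R m.+1 1 ltr01.
have ballE : unit_ball_volume m.+1 = w.
  by rewrite /unit_ball_volume -[unit_ball _]/(eball m.+1 1) wE.
have m1 : 0 < m%:R :> R by rewrite ltr0n.
have nuE eta : ((m.+1%:R * unit_ball_volume m.+1)%:E * affine_dual_curvature K eta =
    (m%:R : R)%:E * \int[spherical_measure m.+1]_(u in reverse_radial_gauss K eta)
    (radial_function K u ^+ m *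
     radial_function (intersection_body (intersection_body K)) u)%:E)%E.
  rewrite /affine_dual_curvature muleA -EFinM ballE; congr (_%:E * _)%E.
  by rewrite mulrC divfK// mulf_neq0// ?pnatr_eq0// gt_eqF.
have gauss0 : reverse_radial_gauss K set0 = set0.
  by apply/seteqP; split=> // x [v [[]]].
have gaussS eta u : reverse_radial_gauss K eta u -> unit_sphere m.+1 u.
  by move=> [v _ []].
have density1_ge0 u : 0 <= radial_function K u ^+ m *
    radial_function (intersection_body (intersection_body K)) u.
  by rewrite mulr_ge0 ?exprn_ge0 ?radial_function_ge0.
have density_ge0 p u : 0 <= radial_function K u `^ (m.+1%:R - p) *
    cosine_transform (- p) (fun u => radial_function (Lp_intersection_body p K) u `^
      (m.+1%:R - p)) u.
  rewrite mulr_ge0 ?powR_ge0//; apply: Rintegral_ge0 => x _.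
  by rewrite mulr_ge0 ?powR_ge0.
move=> f _; apply: cvg_integral_set_function.
- by move=> p; rewrite /p_affine_dual_curvature gauss0 integral_set0 mule0.
- by rewrite nuE gauss0 integral_set0 mule0.
(* The prefactor is negative for p > 1, so nonnegativity is claimed only to the left of 1. *)
- apply: (@near_left1 _ _ 1) => // p /andP[p0 p1] _ A.
  apply: mule_ge0; first by rewrite lee_fin divr_ge0 ?subr_ge0 ?(ltW p1)// mulr_ge0.
  by apply: integral_ge0 => u _; rewrite lee_fin density_ge0.
- move=> A; rewrite nuE; apply: mule_ge0; first by rewrite lee_fin ltW.
  by apply: integral_ge0 => u /gaussS uS; rewrite lee_fin density1_ge0.
move=> e e0; have near01 : \forall p \near (1 : R)^'-, 0 < p < 1.
  by apply: (@near_left1 _ _ 1).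
(* The closeness of p to 1 depends on e alone; as alpha*_K(A) consists of unit vectors, the same
   pointwise bounds serve all sets A at once. *)
have := mequiv_density m0 tK e0.
apply: filterS2 near01 => p /andP[p0 p1] H A _.
have c0 : 0 < (1 - p) / (2 * `|p|) by rewrite divr_gt0 ?subr_gt0// mulr_gt0// normr_gt0 gt_eqF.
rewrite nuE /p_affine_dual_curvature; split; apply: ge0_scale_integral_le => //.
- exact: expR_gt0.
- by move=> u _; rewrite lee_fin density_ge0.
- move=> u /gaussS uS; rewrite -!EFinM lee_fin.
  by have [] := H u uS.
- exact: expR_gt0.
- by move=> u /gaussS uS; rewrite lee_fin density1_ge0.
- move=> u /gaussS uS; rewrite -!EFinM lee_fin.
  by have [] := H u uS.
Qed.
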